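(* Let $\Gamma$ be a connected $\mathbb{Z}^d$-periodic graph that is minimally sparse. Then $\Gamma$ satisfies the spectral edges conjecture: for generic parameters $(V,E)$, the extrema of the dispersion relation are isolated, nondegenerate, and each occurs on a single spectral band function.
   Context: Let $d>0$ be an integer and $\mathbb{T}$ the unit complex numbers. A $\mathbb{Z}^d$-periodic graph $\Gamma$ is a graph with vertex set $\mathcal{V}$ and edge set $\mathcal{E}$, equipped with a free cocompact action of $\mathbb{Z}^d$ (finitely many orbits on $\mathcal{V}$ and on $\mathcal{E}$); the action of $a\in\mathbb{Z}^d$ on $v$ is written $a+v$. $W\subset\mathcal{V}$ is a finite set of orbit representatives. Parameters for $\Gamma$ are pairs $(V,E)$ of $\mathbb{Z}^d$-periodic functions $V\colon\mathcal{V}\to\mathbb{R}$, $E\colon\mathcal{E}\to\mathbb{R}$ (edges undirected); they form a real vector space of dimension equal to the number of $\mathbb{Z}^d$-orbits on $\mathcal{V}\cup\mathcal{E}$. ''Generic'' means: on the complement of a proper algebraic subset of the parameter space. The Floquet matrix $H(z)$, $z=(z_1,\dots,z_d)$, is the $|W|\times|W|$ matrix with $(v,u)$-entry $V(v)\delta_{v,u}+\sum_{(v,a+u)\in\mathcal{E}}E(v,a+u)z^a$, where $z^a=z_1^{a_1}\cdots z_d^{a_d}$. The dispersion polynomial is $D(z,\lambda)=\det(H(z)-\lambda)$. For $z\in\mathbb{T}^d$, $H(z)$ is Hermitian; its ordered eigenvalues $\lambda_1(z)\le\dots\le\lambda_{|W|}(z)$ are the spectral band functions $\mathbb{T}^d\to\mathbb{R}$,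 and the union of their graphs is the dispersion relation. An extremum of the dispersion relation is a point $(x,\lambda_0)$ with $\lambda_0=\lambda_j(x)$ where $\lambda_j$ has a local maximum or minimum at $x$; it is nondegenerate if the Hessian of the band function is invertible there; it occurs on a single spectral band function if it lies on the graph of only one of them. A polynomial $D(z,\lambda)$ is minimally sparse if the only nonconstant monomials in $z$ which occur in it (with coefficients polynomials in $\lambda$) are $z_i^{\pm1}$, $i=1,\dots,d$. The graph $\Gamma$ is minimally sparse if for generic parameters its dispersion polynomial is minimally sparse. *)

(* Defs.v *)
From HB Require Import structures.
From mathcomp Require Import all_boot all_order all_algebra.
From mathcomp Require Import fraction complex.
(* The notations of mpoly clash with those of mathcomp-analysis. *)
From mathcomp Require Import -(notations) mpoly.
From mathcomp Require Import all_classical all_reals all_analysis.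

Set Implicit Arguments.
Unset Strict Implicit.
Unset Printing Implicit Defensive.

Import Order.TTheory GRing.Theory Num.Theory.
Import numFieldNormedType.Exports.

Local Open Scope classical_set_scope.
Local Open Scope ring_scope.

(* Edges are unordered pairs of vertices, encoded by a symmetric adjacency
   relation; loops are allowed.  Freeness of the action on edges follows from
   freeness on vertices, Z^d being torsion free. *)
Record periodic_graph (d : nat) := PeriodicGraph {
  vertex :> Type;
  translate : 'rV[int]_d -> vertex -> vertex;
  adj : rel vertex;
  translate0 : forall v, translate 0 v = v;
  translateD : forall a b v, translate (a + b) v = translate a (translate b v);
  translate_free : forall a v, translate a v = v -> a = 0;
  adj_sym : forall u v, adj u v = adj v u;
  adj_translate : forall a u v, adj (translate a u) (translate a v) = adj u v;
  vertex_cocompact : exists F : set vertex, finite_set F /\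
    forall v, exists a u, F u /\ v = translate a u;
  edge_cocompact : exists F : set (vertex * vertex), finite_set F /\
    forall u v, adj u v ->
      exists a e, F e /\ u = translate a e.1 /\ v = translate a e.2 }.

Definition connected_graph (d : nat) (Gamma : periodic_graph d) : Prop :=
  forall u v : Gamma, exists s : seq Gamma, path (@adj d Gamma) u s /\ last u s = v.

Definition orbit_representatives (d : nat) (Gamma : periodic_graph d)
    (n : nat) (W : 'I_n -> Gamma) : Prop :=
  forall v : Gamma, exists! ia : 'I_n * 'rV[int]_d, v = translate ia.2 (W ia.1).

(* The edge function E is extended by 0 to the pairs that are not edges. *)
Record parameters (R : realType) (d : nat) (Gamma : periodic_graph d) :=
  MkParams {
  potential : Gamma -> R;
  edge_label : Gamma -> Gamma -> R;
  potential_periodic : forall a v, potential (translate a v) = potential v;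
  edge_label_periodic : forall a u v,
    edge_label (translate a u) (translate a v) = edge_label u v;
  edge_label_sym : forall u v, edge_label u v = edge_label v u;
  edge_label_supp : forall u v, ~~ adj u v -> edge_label u v = 0 }.

Section Genericity.
Variables (R : realType) (d : nat) (Gamma : periodic_graph d).

Definition coordinate (t : Gamma + Gamma * Gamma) (p : parameters R Gamma) : R :=
  match t with
  | inl v => potential p v
  | inr e => edge_label p e.1 e.2
  end.

(* The values of V and E span the dual of the parameter space, so these are
   its polynomial functions, described without choosing a basis. *)
Definition polynomial_function (f : parameters R Gamma -> R) : Prop :=
  exists (N : nat) (t : 'I_N -> Gamma + Gamma * Gamma) (P : mpoly N R),
    forall p, f p = meval (fun i => coordinate (t i) p) P.

Definition algebraic_subset (S : set (parameters R Gamma)) : Prop :=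
  exists F : set (parameters R Gamma -> R),
    F `<=` polynomial_function /\ S = [set p | forall f, F f -> f p = 0].

Definition generic (P : parameters R Gamma -> Prop) : Prop :=
  exists S : set (parameters R Gamma),
    [/\ algebraic_subset S, S <> setT & forall p, ~ S p -> P p].

End Genericity.

Definition monomial (K : fieldType) (d : nat) (z : 'I_d -> K)
    (a : 'rV[int]_d) : K :=
  \prod_(k < d) z k ^ a 0 k.

(* The values z may be complex numbers or, in the field of rational functions,
   indeterminates; iota embeds the real parameters in K.  The sum ranges over a
   finite set of translations a. *)
Definition Floquet (R : realType) (d : nat) (Gamma : periodic_graph d)
    (n : nat) (W : 'I_n -> Gamma) (K : fieldType) (iota : {rmorphism R -> K})
    (z : 'I_d -> K) (p : parameters R Gamma) : 'M[K]_n :=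
  \matrix_(i, j) (iota (potential p (W i)) *+ (i == j) +
    \sum_(a \in [set a | adj (W i) (translate a (W j))])
      iota (edge_label p (W i) (translate a (W j))) * monomial z a).

Section MinimallySparse.
Variables (R : realType) (d : nat).

(* Laurent polynomials in z are regarded as rational functions; polynomials in
   lambda are univariate polynomials over them. *)
Definition ratfun : fieldType := {fraction (mpoly d R)}.

Definition ratfunC : {rmorphism R -> ratfun} :=
  (@tofrac (mpoly d R)) \o (@mpolyC d R).

Definition indeterminate (k : 'I_d) : ratfun := tofrac (mpolyX R (mnm1 k)).

Definition minimally_sparse_poly (D : {poly ratfun}) : Prop :=
  exists (c0 : {poly R}) (cp cm : 'I_d -> {poly R}),
    D = map_poly ratfunC c0 +
        \sum_(k < d) (map_poly ratfunC (cp k) * (indeterminate k)%:P +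
                      map_poly ratfunC (cm k) * ((indeterminate k)^-1)%:P).

Definition dispersion_poly (Gamma : periodic_graph d) (n : nat)
    (W : 'I_n -> Gamma) (p : parameters R Gamma) : {poly ratfun} :=
  \det (map_mx polyC (Floquet W ratfunC indeterminate p) - 'X%:M).

Definition minimally_sparse (Gamma : periodic_graph d) (n : nat)
    (W : 'I_n -> Gamma) : Prop :=
  generic (fun p : parameters R Gamma =>
    minimally_sparse_poly (dispersion_poly W p)).

End MinimallySparse.

Section Bands.
Variables (R : realType) (d : nat) (Gamma : periodic_graph d) (n : nat).
Variables (W : 'I_n -> Gamma) (p : parameters R Gamma).

Local Notation point := ('rV[(R[i])^o]_d).

Definition torus : set point := [set z | forall k, `|z 0 k| = 1].

Definition complex_embedding : {rmorphism R -> R[i]} := real_complex R.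

(* With algebraic multiplicities. *)
Definition eigenvalues (A : 'M[R[i]]_n) : seq R[i] :=
  sval (closed_field_poly_normal (char_poly A)).

(* The eigenvalues are real when z lies on the torus, so taking real parts
   loses nothing. *)
Definition band (j : 'I_n) (z : point) : R :=
  nth 0 (sort <=%O (map (@complex.Re R)
    (eigenvalues (Floquet W complex_embedding (z 0) p)))) j.

Definition local_extremum (j : 'I_n) (x : point) : Prop :=
  (\forall y \near within torus (nbhs x), band j y <= band j x) \/
  (\forall y \near within torus (nbhs x), band j x <= band j y).

Definition extrema : set (point * R) :=
  [set e | torus e.1 /\ exists j, band j e.1 = e.2 /\ local_extremum j e.1].

Definition torus_chart (x : point) (t : 'rV[R]_d) : point :=
  \row_k (x 0 k * (cos (t 0 k) +i* sin (t 0 k))%C).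

Definition partial_derivative (k : 'I_d) (g : 'rV[R]_d -> R) : 'rV[R]_d -> R :=
  'D_(delta_mx 0 k) g.

Definition Hessian (g : 'rV[R]_d -> R) (t : 'rV[R]_d) : 'M[R]_d :=
  \matrix_(k, l) partial_derivative k (partial_derivative l g) t.

(* Derivatives are total in the library, hence the explicit requirement that
   the band function be twice differentiable at x.  At a critical point,
   invertibility of the Hessian does not depend on the chart. *)
Definition nondegenerate_at (j : 'I_n) (x : point) : Prop :=
  let g := band j \o torus_chart x in
  [/\ \forall t \near (0 : 'rV[R]_d), differentiable g t,
      forall k, differentiable (partial_derivative k g) (0 : 'rV[R]_d)
    & Hessian g 0 \in unitmx].

Definition on_single_band (e : point * R) : Prop :=
  exists! j, band j e.1 = e.2.

Definition spectral_edges_property : Prop :=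
  forall e, extrema e ->
    [/\ isolated extrema e,
        forall j, band j e.1 = e.2 -> local_extremum j e.1 ->
          nondegenerate_at j e.1
      & on_single_band e].

End Bands.

Definition spectral_edges_conjecture (R : realType) (d : nat)
    (Gamma : periodic_graph d) (n : nat) (W : 'I_n -> Gamma) : Prop :=
  generic (fun p : parameters R Gamma => spectral_edges_property W p).

(* Main.v *)
Require Import Defs.
From mathcomp Require Import all_boot all_order all_algebra all_reals.
From mathcomp Require Import ring lra zify.
From mathcomp Require Import boolp.

(* On the torus a minimally sparse dispersion relation reads
     f(z, l) = c_0(l) + sum_k c_k(l) Re z_k = 0.
   Let (x, l) be an extremum of a band.  If c_k(l) <> 0 and x_k is not real, then
   moving x_k along its circle makes Re x_k, which the band value determines,
   injective near x; so the band is injective, hence monotone, along this curve,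
   a contradiction.  Thus c_k(l) = 0 or x_k = +-1 for every k.  If some c_k(l)
   vanished, l would be a common eigenvalue of H(e) and H(e') for two points e, e'
   of {+-1}^d that differ only in coordinate k.  So if H(e) and H(e') never have a
   common eigenvalue and each H(e) has simple spectrum, then every extremum lies
   over a point of {+-1}^d, and the Hessian there is diagonal with nonzero entries
   proportional to the c_k(l).

   These two conditions say that the polynomials det chi_{H(e')}(H(e)) and
   det chi'_{H(e)}(H(e)) in the parameters do not vanish, so only one good
   parameter is needed for each.  Simplicity holds for distinct potentials and
   E = 0.  For the other one, twisting the edge labels by signs reduces to
   e = (1, ..., 1), where H(e') is the matrix of the same graph with signs, and by
   connectedness these signs are not a coboundary.  Take a spanning tree, grown leaf
   by leaf so that no eigenvector has a zero entry, and one more edge that unbalances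
   it: the two signs of this edge then give disjoint spectra for generic weights. *)

Set Implicit Arguments.
Unset Strict Implicit.
Unset Printing Implicit Defensive.
Import Order.TTheory GRing.Theory Num.Theory.
Local Open Scope ring_scope.

(** * Signed graphs with disjoint spectra *)

Section SpectralLemmas.
Variables (K : numClosedFieldType) (n : nat).
Implicit Types (A : 'M[K]_n) (S : {set 'I_n}) (psi phi : 'rV[K]_n).

(* Rows outside S are made unimodular, so that the kernel of this matrix is the
   lambda-eigenspace of the principal submatrix of A indexed by S. *)
Definition restricted_pencil S A (lambda : K) : 'M[K]_n :=
  A + diag_mx (\row_i (if i \in S then - lambda else 1)).

Definition supported S A := forall i j, A i j != 0 -> (i \in S) && (j \in S).

(** The invariant of the construction of the tree. For nonempty [S] it forces every eigenspace to be
    at most a line, since two independent eigenvectors would combine into one with a zero entry. *)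
Definition nowhere_zero_eigenvectors S A :=
  forall lambda psi, psi != 0 -> psi *m restricted_pencil S A lambda = 0 ->
  forall i, i \in S -> psi 0 i != 0.

Lemma mul_restricted_pencil S A lambda psi j :
  (psi *m restricted_pencil S A lambda) 0 j =
  (psi *m A) 0 j + psi 0 j * (if j \in S then - lambda else 1).
Proof. by rewrite /restricted_pencil mulmxDr mul_mx_diag !mxE. Qed.

Lemma restricted_pencilT A lambda :
  restricted_pencil setT A lambda = A - lambda%:M.
Proof.
congr (_ + _); apply/matrixP => i j; rewrite !mxE inE.
by case: eqP => _; rewrite ?mulr1n ?mulr0n ?oppr0.
Qed.

Lemma trmx_restricted_pencil S A lambda :
  A^T = A -> (restricted_pencil S A lambda)^T = restricted_pencil S A lambda.
Proof. by move=> sA; rewrite /restricted_pencil raddfD /= sA tr_diag_mx. Qed.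

(** The kernel of a symmetric matrix is orthogonal to its image for the bilinear pairing, without
    conjugation. *)
Lemma kernel_pairing (N : 'M[K]_n) phi psi c u : N^T = N ->
  phi *m N = 0 -> psi *m N = c *: delta_mx 0 u -> phi 0 u * c = 0.
Proof.
move=> sN kphi hpsi.
have : psi *m N *m phi^T = 0.
  by rewrite -mulmxA -[N]sN -trmx_mul kphi trmx0 mulmx0.
rewrite hpsi -scalemxAl -rowE => /(congr1 (fun M : 'M_1 => M 0 0)).
by rewrite !mxE mulrC.
Qed.

End SpectralLemmas.

(** Cayley-Hamilton for the whole of [A], started at the basis vector of [u]: the linear factors of
    the characteristic polynomial are applied one by one, and the first that kills the current
    vector provides the eigenvalue. The vectors stay supported in [S], so no submatrix has to be
    extracted. *)
Lemma exists_eigenvector (K : numClosedFieldType) n (S : {set 'I_n})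
    (A : 'M[K]_n) u : u \in S -> supported S A ->
  exists lambda (psi : 'rV[K]_n), psi != 0 /\ psi *m restricted_pencil S A lambda = 0.
Proof.
case: n S A u => [|n] S A u uS supA; first by case: u uS.
have zeroA (psi : 'rV[K]_n.+1) j : j \notin S -> (psi *m A) 0 j = 0.
  move=> jS; rewrite mxE big1 // => i _; apply/eqP; rewrite mulf_eq0.
  apply/orP; right; apply: contraNT jS => /supA /andP[_ //].
have mulB (psi : 'rV[K]_n.+1) r j :
    (psi *m (A - r%:M)) 0 j = (psi *m A) 0 j - psi 0 j * r.
  by rewrite mulmxBr mul_mx_scalar !mxE [r * _]mulrC.
have krylov (rs : seq K) (psi : 'rV[K]_n.+1) : psi != 0 ->
    (forall j, j \notin S -> psi 0 j = 0) ->
    psi *m horner_mx A (\prod_(r <- rs) ('X - r%:P)) = 0 ->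
    exists lambda (phi : 'rV[K]_n.+1), phi != 0 /\
      phi *m restricted_pencil S A lambda = 0.
  elim: rs psi => [|r rs IH] psi psi0 suppsi.
    rewrite big_nil rmorph1 -[1]/(1%:M) mulmx1 => psi00.
    by rewrite psi00 eqxx in psi0.
  rewrite big_cons mulrC rmorphM /= comm_horner_mx2 mulmxA.
  rewrite rmorphB /= horner_mx_X horner_mx_C.
  case: (eqVneq (psi *m (A - r%:M)) 0) => [e _|ne].
    exists r, psi; split=> //; apply/rowP => j; rewrite mul_restricted_pencil [RHS]mxE.
    case: ifP => jS.
      by rewrite mulrN -mulB e mxE.
    by rewrite suppsi ?jS // zeroA ?jS // mul0r addr0.
  apply: IH => // j jS.
  by rewrite mulB suppsi // mul0r subr0 zeroA.
have [rs def_rs] := closed_field_poly_normal (char_poly A).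
have := Cayley_Hamilton A; rewrite def_rs (monicP (char_poly_monic A)) scale1r.
move=> hCH; apply: (krylov rs (delta_mx 0 u)).
- by apply/eqP => /rowP/(_ u)/eqP; rewrite !mxE !eqxx oner_eq0.
- by move=> j jS; rewrite mxE eqxx /=; case: eqP jS => // ->; rewrite uS.
- by rewrite hCH mulmx0.
Qed.

(** * Adding a leaf to a graph *)

Section LeafStep.
Variables (K : numClosedFieldType) (n : nat).
Implicit Types (A : 'M[K]_n) (S : {set 'I_n}) (psi phi : 'rV[K]_n).

(* At an eigenvalue lambda of A, replacing a column of the pencil by a basis
   vector makes it invertible, because no eigenvector has a zero entry. *)
Lemma finite_green_zeros S A u i : u \in S -> i \in S ->
  A^T = A -> supported S A -> nowhere_zero_eigenvectors S A ->
  exists bad : seq K, forall lambda psi c, psi != 0 ->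
    psi *m restricted_pencil S A lambda = c *: delta_mx 0 u -> psi 0 i = 0 ->
    lambda \in bad.
Proof.
move=> uS iS sA supA nzA.
(* The pencil with [lambda] as an indeterminate and column [u] replaced by the basis column of [i].
   A row [psi] with [psi 0 i = 0] that the pencil maps to a multiple of [delta_mx 0 u] lies in its
   left kernel, so the determinant vanishes at [lambda]. *)
pose Q := \matrix_(a, b) (if b == u then (a == i)%:R else
   (A a b)%:P + (if b \in S then - 'X else 1) *+ (a == b)) : 'M[{poly K}]_n.
pose Qe lambda := \matrix_(a, b) (if b == u then (a == i)%:R else
   restricted_pencil S A lambda a b) : 'M[K]_n.
have evQ lambda : (\det Q).[lambda] = \det (Qe lambda).
  rewrite -[LHS]/(horner_eval lambda _) -det_map_mx; congr (\det _).
  apply/matrixP => a b; rewrite !mxE /= /horner_eval; case: eqP => _.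
    by rewrite -polyC_natr hornerC.
  rewrite hornerD hornerC hornerMn mulrb; case: eqP => [->|_]; last first.
    by rewrite mulr0n addr0.
  by case: ifP; rewrite ?hornerN ?hornerX ?hornerC mulr1n.
have mulQe lambda psi : psi *m Qe lambda =
    \row_j (if j == u then psi 0 i else (psi *m restricted_pencil S A lambda) 0 j).
  apply/rowP => j; rewrite !mxE; case: (eqVneq j u) => [->|ju].
    rewrite (bigD1 i) //= mxE !eqxx mulr1 big1 ?addr0 // => k /negPf ki.
    by rewrite !mxE eqxx ki mulr0.
  by apply: eq_bigr => k _; rewrite !mxE (negPf ju).
have [l0 [phi [phi0 kphi]]] := exists_eigenvector uS supA.
have detQ0 : \det Q != 0.
  apply/negP => /eqP detQ; have := evQ l0; rewrite detQ horner0.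
  move/esym/eqP/det0P => [psi psi0]; rewrite mulQe => hpsi.
  have psii : psi 0 i = 0 by move/rowP/(_ u): hpsi; rewrite !mxE eqxx.
  have hc : psi *m restricted_pencil S A l0 =
      (psi *m restricted_pencil S A l0) 0 u *: delta_mx 0 u.
    apply/rowP => j; rewrite [RHS]mxE [X in _ * X]mxE eqxx /=;
      case: (eqVneq j u) => [->|ju].
      by rewrite mulr1.
    by move/rowP/(_ j): hpsi; rewrite mulr0 mxE (negPf ju) [RHS]mxE.
  (* As [phi 0 u] is nonzero, the pairing kills the coefficient, and [psi] becomes an eigenvector
     that vanishes at [i]. *)
  have := kernel_pairing (trmx_restricted_pencil S l0 sA) kphi hc.
  move/eqP; rewrite mulf_eq0 (negPf (nzA _ _ phi0 kphi _ uS)) /= => /eqP c0.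
  move: hc; rewrite c0 scale0r => kpsi.
  by have := nzA _ _ psi0 kpsi _ iS; rewrite psii eqxx.
have [rs def_rs] := closed_field_poly_normal (\det Q).
exists rs => lambda psi c psi0 hpsi psii.
suff : root (\det Q) lambda.
  by rewrite def_rs rootZ ?lead_coef_eq0 // root_prod_XsubC.
rewrite /root evQ; apply/det0P; exists psi => //; rewrite mulQe.
apply/rowP => j; rewrite [LHS]mxE [RHS]mxE; case: eqP => // /eqP ju.
by rewrite hpsi !mxE (negPf ju) andbF mulr0.
Qed.

Definition add_leaf A (u v : 'I_n) (x : K) : 'M[K]_n :=
  A + x *: delta_mx v v + delta_mx u v + delta_mx v u.

(** An eigenvector of the enlarged matrix restricts to [chi] on [S], which the old pencil maps to a
    multiple of [delta_mx 0 u]. If its entry at [v] is zero, [chi] is an old eigenvector with a zero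
    at [u]. If its entry at some [i] of [S] is zero, [lambda] is one of finitely many values, and
    each of them allows one potential [x]. *)
Lemma nowhere_zero_add_leaf S A u v : u \in S -> v \notin S ->
  A^T = A -> supported S A -> nowhere_zero_eigenvectors S A ->
  exists bad : seq K, forall x, x \notin bad ->
    nowhere_zero_eigenvectors (v |: S) (add_leaf A u v x).
Proof.
move=> uS vS sA supA nzA.
have uv : u != v by apply: contraNneq vS => <-.
have /choice[bd bdP] : forall i, exists bad : seq K,
    i \in S -> forall lambda psi c, psi != 0 ->
    psi *m restricted_pencil S A lambda = c *: delta_mx 0 u -> psi 0 i = 0 ->
    lambda \in bad.
  move=> i; case: (boolP (i \in S)) => iS; last by exists [::].
  by have [bad h] := finite_green_zeros uS iS sA supA nzA; exists bad.
(* The equation at the leaf is psi_u + (x - l) psi_v = 0, and psi_u = - psi_v G_uu where G is the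
   inverse of the pencil at l; so x = l + G_uu. *)
exists [seq l + invmx (restricted_pencil S A l) u u | i <- enum S, l <- bd i].
move=> x /allpairsPdep xbad lambda psi psi0 hpsi.
have zA i : A v i = 0.
  by apply/eqP; apply: contraNT vS => /supA /andP[].
have Az i : A i v = 0 by rewrite -sA mxE zA.
pose chi := psi - psi 0 v *: delta_mx 0 v.
have chiE j : chi 0 j = if j == v then 0 else psi 0 j.
  rewrite !mxE eqxx /=; case: eqP => [->|_]; first by rewrite mulr1 subrr.
  by rewrite mulr0 subr0.
have chiA : chi *m A = psi *m A.
  rewrite mulmxBl -scalemxAl -rowE; suff -> : row v A = 0 by rewrite scaler0 subr0.
  by apply/rowP => j; rewrite !mxE zA.
have psiE j : (psi *m A) 0 j + psi 0 v * x *+ (j == v) + psi 0 u *+ (j == v)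
   + psi 0 v *+ (j == u) + psi 0 j * (if j \in v |: S then - lambda else 1) = 0.
  move/rowP/(_ j): hpsi; rewrite mul_restricted_pencil [RHS]mxE => <-.
  congr (_ + _); rewrite /add_leaf !mulmxDr -scalemxAr.
  have mulE (a b : 'I_n) : (psi *m delta_mx a b) 0 j = psi 0 a *+ (j == b).
    rewrite mxE (bigD1 a) //= big1 => [|k ka]; last first.
      by rewrite mxE (negPf ka) mulr0.
    by rewrite mxE eqxx addr0 mulr_natr.
  rewrite [RHS]mxE [X in _ = X + _]mxE [X in _ = X + _ + _]mxE.
  by rewrite [X in _ = _ + X + _ + _]mxE !mulE mulrnAr [x * _]mulrC.
have kchi : chi *m restricted_pencil S A lambda = - psi 0 v *: delta_mx 0 u.
  apply/rowP => j; rewrite mul_restricted_pencil chiA chiE.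
  rewrite [RHS]mxE [X in _ = _ * X]mxE eqxx /= mulr_natr.
  case: (eqVneq j v) => [->|jv].
    rewrite mul0r addr0 eq_sym (negPf uv) mulr0n mxE big1 // => i _.
    by rewrite Az mulr0.
  have := psiE j; rewrite (negPf jv) !mulr0n !addr0 in_setU1 (negPf jv) /=.
  move/eqP; rewrite addrAC addr_eq0 => /eqP ->.
  by rewrite mulNrn.
have psiv : (psi 0 u + (x - lambda) * psi 0 v = 0).
  have := psiE v; rewrite eqxx eq_sym (negPf uv) mulr0n addr0 setU11 !mulr1n.
  rewrite mxE big1 => [|i _]; last by rewrite Az mulr0.
  by move=> <-; ring.
have psiv0 : psi 0 v != 0.
  apply/eqP => pv0; move: psiv; rewrite pv0 mulr0 addr0 => pu0.
  have chipsi : chi = psi by rewrite /chi pv0 scale0r subr0.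
  move: kchi; rewrite chipsi pv0 oppr0 scale0r => kpsi.
  by have := nzA _ _ psi0 kpsi _ uS; rewrite pu0 eqxx.
move=> i; rewrite in_setU1 => /predU1P[->//|iS].
apply/eqP => pi0; apply: xbad; exists i, lambda.
have iv : i != v by apply: contraNneq vS => <-.
have chi0 : chi != 0.
  apply/eqP => c0; move: kchi; rewrite c0 mul0mx => /rowP/(_ u)/eqP.
  by rewrite !mxE !eqxx mulr1 eq_sym oppr_eq0 (negPf psiv0).
split; first by rewrite mem_enum.
  by apply: (bdP i iS _ chi (- psi 0 v)) => //; rewrite chiE (negPf iv).
(* The multiple of [delta_mx 0 u] in [kchi] is nonzero, so a kernel vector would vanish at [u]. *)
have uN : restricted_pencil S A lambda \in unitmx.
  rewrite unitmxE unitfE; apply/det0P => -[phi phi0 kphi].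
  have := kernel_pairing (trmx_restricted_pencil S lambda sA) kphi kchi.
  move/eqP; rewrite mulf_eq0 oppr_eq0 (negPf psiv0) orbF.
  by rewrite (negPf (nzA _ _ phi0 kphi _ uS)).
have := congr1 (fun M : 'rV_n => (M *m invmx (restricted_pencil S A lambda)) 0 u) kchi.
rewrite mulmxK // chiE (negPf uv) -scalemxAl -rowE !mxE => pu.
apply: (mulIf psiv0); move: psiv; rewrite pu => /eqP; rewrite addrC addr_eq0.
by move/eqP => h; rewrite mulrDl -[x](subrK lambda) mulrDl h; ring.
Qed.
End LeafStep.

(** * Perturbing a symmetric matrix by plus or minus one edge *)

Section ClosingEdge.
Variables (K : numClosedFieldType) (n : nat) (T : 'M[K]_n).
Hypothesis symT : T^T = T.
Hypothesis nzT : nowhere_zero_eigenvectors setT T.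
Implicit Types (u v : 'I_n) (psi phi : 'rV[K]_n).

(** For [u = v] this is a loop, with a single entry 1 and not 2 on the diagonal. *)
Definition edge_mx (u v : 'I_n) : 'M[K]_n :=
  \matrix_(i, j) ((i == u) && (j == v) || (i == v) && (j == u))%:R.

Let N lambda := restricted_pencil setT T lambda.

Lemma mul_edge_mx u v psi : u != v ->
  psi *m edge_mx u v = psi 0 u *: delta_mx 0 v + psi 0 v *: delta_mx 0 u.
Proof.
move=> uv; apply/rowP => j; rewrite !mxE (bigD1 u) //= (bigD1 v) 1?eq_sym //=.
rewrite big1 => [|i /andP[/negPf iu /negPf iv]]; last first.
  by rewrite mxE iu iv mulr0.
by rewrite !mxE !eqxx [v == u]eq_sym (negPf uv) /= orbF addr0 addrC [v == j]eq_sym addrC.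
Qed.

Lemma mul_loop_mx u psi : psi *m edge_mx u u = psi 0 u *: delta_mx 0 u.
Proof.
apply/rowP => j; rewrite !mxE (bigD1 u) //= big1 => [|i /negPf iu]; last first.
  by rewrite mxE iu mulr0.
by rewrite !mxE !eqxx /= orbb addr0.
Qed.

Lemma pencil_of_perturbation lambda E u v psi :
  psi *m (T + E *: edge_mx u v) = lambda *: psi ->
  psi *m N lambda = - E *: (psi *m edge_mx u v).
Proof.
rewrite /N restricted_pencilT mulmxDr mulmxBr -scalemxAr mul_mx_scalar => <-.
by rewrite opprD addrA subrr sub0r scaleNr.
Qed.

Lemma pencil_pairing lambda psi phi :
  psi *m N lambda *m phi^T = (phi *m N lambda *m psi^T)^T.
Proof. by rewrite !trmx_mul trmxK trmx_restricted_pencil // mulmxA. Qed.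

Lemma no_zero_entry lambda u psi :
  psi != 0 -> psi 0 u = 0 -> psi *m N lambda = 0 -> False.
Proof.
move=> psi0 pu kpsi.
by have := nzT psi0 kpsi (in_setT u); rewrite pu eqxx.
Qed.

(** Symmetry of the pencil gives 2 E psi_u phi_u = 0, so one of the two vectors is an eigenvector of
    [T] with a zero at [u]. *)
Lemma closing_loop u E lambda psi phi : E != 0 -> psi != 0 -> phi != 0 ->
  psi *m (T + E *: edge_mx u u) = lambda *: psi ->
  phi *m (T - E *: edge_mx u u) = lambda *: phi -> False.
Proof.
move=> E0 psi0 phi0 /pencil_of_perturbation hpsi.
rewrite -scaleNr => /pencil_of_perturbation hphi.
have := pencil_pairing lambda psi phi; rewrite hpsi hphi opprK !mul_loop_mx.
rewrite -!scalemxAl -!rowE => /(congr1 (fun M : 'M_1 => M 0 0)).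
rewrite !mxE => /eqP; rewrite mulNr -subr_eq0 -opprD oppr_eq0 [phi _ _ * _]mulrC.
rewrite -mulr2n mulrn_eq0 /= mulf_eq0 (negPf E0) mulf_eq0 /=.
case/orP => /eqP z.
  by apply: (@no_zero_entry lambda _ _ psi0 z);
    rewrite hpsi mul_loop_mx z scale0r scaler0.
by apply: (@no_zero_entry lambda _ _ phi0 z); rewrite hphi mul_loop_mx z scale0r scaler0.
Qed.

(** If psi_v = 0, then psi_u is nonzero and the last relation gives phi_v = 0. Then [chi] is in the
    kernel of the pencil and vanishes at [v], hence is zero; its entry 2 psi_u phi_u at [u] gives
    phi_u = 0, and [phi] is an eigenvector of [T] with a zero entry. *)
Lemma closing_entry_neq0 u v E lambda psi phi : psi != 0 -> phi != 0 ->
  psi *m N lambda = - E *: (psi 0 u *: delta_mx 0 v + psi 0 v *: delta_mx 0 u) ->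
  phi *m N lambda = E *: (phi 0 u *: delta_mx 0 v + phi 0 v *: delta_mx 0 u) ->
  psi 0 u * phi 0 v + psi 0 v * phi 0 u = 0 -> psi 0 v != 0.
Proof.
move=> psi0 phi0 hpsi hphi orth; apply/eqP => b0.
have a0 : psi 0 u != 0.
  apply/eqP => a0; apply: (@no_zero_entry lambda _ _ psi0 a0).
  by rewrite hpsi a0 b0 !scale0r addr0 scaler0.
have d0 : phi 0 v = 0.
  move: orth; rewrite b0 mul0r addr0 => /eqP; rewrite mulf_eq0 (negPf a0).
  by move/eqP.
pose chi := phi 0 u *: psi + psi 0 u *: phi.
have kchi : chi *m N lambda = 0.
  rewrite mulmxDl -!scalemxAl hpsi hphi b0 d0 !scale0r !addr0 !scalerA.
  by rewrite -scalerDl; apply/rowP => j; rewrite !mxE; ring.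
have chiv : chi 0 v = 0 by rewrite !mxE b0 d0 !mulr0 addr0.
have [chi0|chi0] := eqVneq chi 0; last first.
  exact: (no_zero_entry chi0 chiv kchi).
have : chi 0 u = 0 by rewrite chi0 mxE.
rewrite !mxE mulrC -mulr2n => /eqP; rewrite mulrn_eq0 mulf_eq0 (negPf a0) /=.
move=> /eqP c0; apply: (@no_zero_entry lambda _ _ phi0 c0).
by rewrite hphi c0 d0 !scale0r addr0 scaler0.
Qed.

(* Eigenvectors psi, phi of the two perturbations for the same lambda combine into
   g, h with g (T - lambda) along e_u, g_v = 0, h (T - lambda) along e_v, h_u = 0.
   So the Green function of T vanishes at (u, v), which allows finitely many
   lambda, and E^2 G_uu G_vv = 1. *)
Lemma closing_edge u v : u != v ->
  exists bad : seq K, forall E, E != 0 -> E ^+ 2 \notin bad ->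
    forall lambda psi phi, psi != 0 -> phi != 0 ->
    psi *m (T + E *: edge_mx u v) = lambda *: psi ->
    phi *m (T - E *: edge_mx u v) = lambda *: phi -> False.
Proof.
move=> uv.
have supT : supported setT T by move=> i j _; rewrite !in_setT.
have [bad badP] := finite_green_zeros (in_setT u) (in_setT v) symT supT nzT.
pose G lambda := invmx (N lambda).
exists [seq (G l u u * G l v v)^-1 | l <- bad].
move=> E E0 Ebad lambda psi phi psi0 phi0 /pencil_of_perturbation hpsi.
rewrite -scaleNr => /pencil_of_perturbation; rewrite opprK => hphi.
rewrite mul_edge_mx // in hpsi; rewrite mul_edge_mx // in hphi.
set a := psi 0 u in hpsi; set b := psi 0 v in hpsi.
set c := phi 0 u in hphi; set d := phi 0 v in hphi.
(* The pairing of [psi] and [phi] through the symmetric pencil equals both - E (a d + b c) and E (a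
   d + b c). *)
have orth : a * d + b * c = 0.
  have := pencil_pairing lambda psi phi; rewrite hpsi hphi.
  rewrite -!scalemxAl !mulmxDl -!scalemxAl -!rowE.
  move=> /(congr1 (fun M : 'M_1 => M 0 0)); rewrite !mxE -/a -/b -/c -/d => /eqP.
  rewrite -subr_eq0 => /eqP h.
  have /eqP : - 2 * (E * (a * d + b * c)) = 0 by rewrite -h; ring.
  by rewrite !mulf_eq0 (negPf E0) oppr_eq0 pnatr_eq0 /= => /eqP.
have b0 : b != 0 by exact: (closing_entry_neq0 psi0 phi0 hpsi hphi orth).
have hpsi' : psi *m N lambda = - E *: (b *: delta_mx 0 u + a *: delta_mx 0 v).
  by rewrite addrC.
have hphi' : phi *m N lambda = E *: (d *: delta_mx 0 u + c *: delta_mx 0 v).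
  by rewrite addrC.
have a0 : a != 0.
  by apply: (closing_entry_neq0 psi0 phi0 hpsi' hphi'); rewrite addrC.
have d0 : d != 0.
  apply: (@closing_entry_neq0 u v (- E) lambda phi psi) => //.
    by rewrite opprK.
  by rewrite -/a -/b -/c -/d -orth; ring.
have c0 : c != 0.
  apply: (@closing_entry_neq0 v u (- E) lambda phi psi) => //.
    by rewrite opprK.
  by rewrite -/a -/b -/c -/d -orth; ring.
pose g := d *: psi - b *: phi; pose h := c *: psi - a *: phi.
have gN : g *m N lambda = - (2 * E * b * d) *: delta_mx 0 u.
  rewrite mulmxBl -!scalemxAl hpsi hphi; apply/rowP => j; rewrite !mxE.
  move: (_ == v)%:R (_ == u)%:R => x y.
  transitivity (- E * (a * d + b * c) * x - 2 * E * b * d * y); first by ring.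
  by rewrite orth; ring.
have hN : h *m N lambda = - (2 * E * a * c) *: delta_mx 0 v.
  rewrite mulmxBl -!scalemxAl hpsi hphi; apply/rowP => j; rewrite !mxE.
  move: (_ == v)%:R (_ == u)%:R => x y.
  transitivity (- E * (a * d + b * c) * y - 2 * E * a * c * x); first by ring.
  by rewrite orth; ring.
have cg0 : - (2 * E * b * d) != 0.
  by rewrite oppr_eq0 !mulf_neq0 // pnatr_eq0.
have g0 : g != 0.
  apply/eqP => g0; move: gN; rewrite g0 mul0mx => /rowP/(_ u)/eqP.
  by rewrite !mxE !eqxx mulr1 eq_sym (negPf cg0).
have lbad : lambda \in bad.
  by apply: (badP _ _ _ g0 gN); rewrite !mxE -/b -/d; ring.
have uN : N lambda \in unitmx.
  rewrite unitmxE unitfE; apply/det0P => -[chi chi0 kchi].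
  have := kernel_pairing (trmx_restricted_pencil _ lambda symT) kchi gN.
  move/eqP; rewrite mulf_eq0 (negPf cg0) orbF.
  by rewrite (negPf (nzT chi0 kchi (in_setT u))).
have hu : g 0 u = - (2 * E * b * d) * G lambda u u.
  have := congr1 (fun M : 'rV_n => (M *m G lambda) 0 u) gN.
  by rewrite mulmxK // -scalemxAl -rowE => ->; rewrite !mxE.
have hv : h 0 v = - (2 * E * a * c) * G lambda v v.
  have := congr1 (fun M : 'rV_n => (M *m G lambda) 0 v) hN.
  by rewrite mulmxK // -scalemxAl -rowE => ->; rewrite !mxE.
have two0 : 2%:R != 0 :> K by rewrite pnatr_eq0.
(* The entry g_u = a d - b c equals 2 a d because a d + b c = 0; in the same way h_v = 2 b c
   below. *)
have ha : a = - E * b * G lambda u u.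
  apply: (mulIf (mulf_neq0 two0 d0)).
  have -> : a * (2 * d) = g 0 u + (a * d + b * c).
    by rewrite !mxE -/a -/b -/c -/d; ring.
  by rewrite orth hu; ring.
have hb : b = - E * a * G lambda v v.
  apply: (mulIf (mulf_neq0 two0 c0)).
  have -> : b * (2 * c) = h 0 v + (a * d + b * c).
    by rewrite !mxE -/a -/b -/c -/d; ring.
  by rewrite orth hv; ring.
have key : E ^+ 2 * (G lambda u u * G lambda v v) = 1.
  apply: (mulIf (mulf_neq0 a0 b0)); rewrite mul1r.
  transitivity ((- E * b * G lambda u u) * (- E * a * G lambda v v)); first by ring.
  by rewrite -ha -hb.
move/negP: Ebad; apply; apply/mapP; exists lambda => //.
have GG : G lambda u u * G lambda v v != 0.
  by apply: contra_eq_neq key => ->; rewrite mulr0 eq_sym oner_eq0.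
by apply: (mulIf GG); rewrite key mulVf.
Qed.
End ClosingEdge.

(** * Weighted signed graphs built on a balanced tree *)

Lemma exists_image_notin (T : eqType) (f : nat -> T) (bad : seq T) :
  injective f -> exists N, f N \notin bad.
Proof.
move=> f_inj; apply: contrapT => allbad.
suff : (size (map f (iota 0 (size bad).+1)) <= size bad)%N.
  by rewrite size_map size_iota ltnn.
apply: uniq_leq_size; first by rewrite map_inj_uniq ?iota_uniq.
move=> x /mapP[N _ ->]; apply/negPn/negP => Nbad.
by apply: allbad; exists N.
Qed.

Section SignedGraph.
Variables (K : numClosedFieldType) (n : nat).
Implicit Types (V : 'I_n -> nat) (w : 'I_n -> 'I_n -> bool -> nat).

(** Edges of both classes may join the same [i] and [j]; [e] decides the sign of those of class
    [true]. Weights are natural numbers, so that the same data define real parameters and complex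
    matrices. *)
Definition signed_mx V w (e : bool) : 'M[K]_n :=
  \matrix_(i, j) ((V i)%:R *+ (i == j) + (w i j false)%:R
                  + (-1) ^+ e * (w i j true)%:R).

Definition joins (u v i j : 'I_n) := (i == u) && (j == v) || (i == v) && (j == u).

Lemma joins_sym u v i j : joins u v i j = joins u v j i.
Proof. by rewrite /joins orbC [(i == v) && _]andbC [(i == u) && _]andbC. Qed.

Variable ed : 'I_n -> 'I_n -> bool -> bool.
Hypothesis ed_sym : forall i j b, ed i j b = ed j i b.
Hypothesis ed_connected : forall S : {set 'I_n}, S != set0 -> S != setT ->
  exists u v b, [/\ u \in S, v \notin S & ed u v b].

(** Balance by [s] means that conjugation by the diagonal signs (-1)^s exchanges
    [signed_mx V w false] and [signed_mx V w true]. This is what the sequel uses of a tree. *)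
Definition good_tree (S : {set 'I_n}) (s : 'I_n -> bool) V w :=
  [/\ forall i j b, w i j b = w j i b,
      forall i j b, w i j b != 0 ->
        [&& ed i j b, i \in S, j \in S & b == s i (+) s j],
      forall i, V i != 0 -> i \in S
    & nowhere_zero_eigenvectors S (signed_mx V w false)].

Lemma good_tree_sym S s V w : good_tree S s V w ->
  (signed_mx V w false)^T = signed_mx V w false.
Proof.
case=> sw _ _ _; apply/matrixP => i j; rewrite !mxE ![w j i _]sw.
by congr (_ + _ + _); rewrite eq_sym; case: eqP => // ->.
Qed.

Lemma good_tree_supported S s V w : good_tree S s V w ->
  supported S (signed_mx V w false).
Proof.
case=> _ hw hV _ i j; rewrite mxE; apply: contraNT => ijS.
have -> : (V i)%:R *+ (i == j) = 0 :> K.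
  case: eqP => [ij|_]; last by rewrite mulr0n.
  rewrite -ij andbb in ijS; case: (eqVneq (V i) 0) => [->|/hV] //.
  by rewrite (negPf ijS).
have w0 b : w i j b = 0.
  apply/eqP; apply: contraNT ijS => /hw /and4P[_ -> -> _] //.
by rewrite !w0 mulr0 !addr0.
Qed.

(** Grows [S] by one vertex at a time: connectedness provides an edge that leaves [S], and its end
    is added as a leaf whose potential avoids the finitely many bad values. *)
Lemma exists_good_tree (u0 : 'I_n) : exists s V w, good_tree setT s V w.
Proof.
suff tree k : (k < n)%N ->
    exists (S : {set 'I_n}) s V w, #|S| = k.+1 /\ good_tree S s V w.
  have n0 : (0 < n)%N := leq_ltn_trans (leq0n u0) (ltn_ord u0).
  have [|S [s [V [w [cS gt]]]]] := tree n.-1; first by rewrite prednK.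
  have ST : S = setT.
    by apply/eqP; rewrite eqEcard subsetT cardsT card_ord cS (prednK n0) leqnn.
  by rewrite -ST; exists s, V, w.
elim: k => [|k IH] kn.
  (* A single vertex with all weights zero: a kernel vector of the pencil vanishes off [u0], hence
     not at [u0]. *)
  exists [set u0], (fun=> false), (fun=> 0%N), (fun _ _ _ => 0%N).
  split; first by rewrite cards1.
  split=> // lambda psi psi0 kpsi i /set1P->; apply/eqP => pu0.
  case/eqP: psi0; apply/rowP => j; rewrite mxE.
  have [->//|ju] := eqVneq j u0.
  move/rowP/(_ j): kpsi; rewrite mul_restricted_pencil in_set1 (negPf ju) mulr1.
  rewrite mxE big1 ?add0r => [->|a _]; first by rewrite mxE.
  by rewrite mxE mul0rn mulr0 !addr0 mulr0.
have [S [s [V [w [cS gt]]]]] := IH (ltnW kn).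
have [||u [v [b [uS vS euv]]]] := @ed_connected S.
- by rewrite -card_gt0 cS.
- by rewrite eqEcard subsetT cardsT card_ord cS -ltnNge.
have [bad badP] : exists bad : seq K, forall x, x \notin bad ->
    nowhere_zero_eigenvectors (v |: S) (add_leaf (signed_mx V w false) u v x).
  apply: nowhere_zero_add_leaf uS vS _ _ _; first exact: good_tree_sym gt.
    exact: good_tree_supported gt.
  by case: gt.
have [|N /badP nzN] := @exists_image_notin _ (fun N => N%:R : K) bad.
  by move=> x y /eqP; rewrite eqr_nat => /eqP.
have uv : u != v by apply: contraNneq vS => <-.
have [sw hw hV nz] := gt.
have w0 i c : w v i c = 0.
  by apply/eqP; apply: contraNT vS => /hw /and4P[].
(* The value of [s] at the leaf is the one that balances the new edge of class [b]. *)
exists (v |: S), (fun i => if i == v then s u (+) b else s i).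
exists (fun i => if i == v then N else V i).
exists (fun i j c => w i j c + joins u v i j * (c == b))%N.
split; first by rewrite cardsU1 vS cS.
split=> [i j c|i j c|i|].
- by rewrite joins_sym sw.
- case: (boolP (joins u v i j)) => [|_]; last first.
    rewrite addn0 => /[dup] wij /hw /and4P[-> iS jS /eqP->] /=.
    rewrite !in_setU1 iS jS !orbT /=.
    have SNv a : a \in S -> a == v = false.
      by move=> aS; apply: contraNF vS => /eqP <-.
    by rewrite !SNv.
  case/orP=> /andP[/eqP-> /eqP->]; rewrite ?[w u v c]sw w0 add0n mul1n eqb0 negbK.
    move=> /eqP->; rewrite euv !in_setU1 uS eqxx orbT /=. rewrite (negPf uv).
    by rewrite addKb.
  move=> /eqP->; rewrite ed_sym euv !in_setU1 uS eqxx orbT /= (negPf uv).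
  by rewrite addbC addKb.
- by rewrite in_setU1; case: (eqVneq i v) => //= _ /hV.
suff -> : signed_mx (fun i => if i == v then N else V i)
   (fun i j c => w i j c + joins u v i j * (c == b))%N false =
   add_leaf (signed_mx V w false) u v N%:R by [].
have Vv : V v = 0 by apply/eqP; apply: contraNT vS => /hV.
apply/matrixP => i j; rewrite !mxE !natrD expr0 !mul1r.
have -> : (if i == v then N else V i)%:R *+ (i == j) =
    (V i)%:R *+ (i == j) + N%:R * ((i == v) && (j == v))%:R :> K.
  case: (eqVneq i v) => [->|_] /=; last by rewrite mulr0 addr0.
  by rewrite Vv mul0rn add0r eq_sym mulr_natr.
have -> : joins u v i j = ((i == u) && (j == v) + (i == v) && (j == u))%N :> nat.
  rewrite /joins; case: (eqVneq i u) => [->|_] //=.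
  by rewrite (negPf uv) /= orbF addn0.
by case: b {euv} => /=; rewrite ?muln0 ?muln1 ?natrD; ring.
Qed.

Hypothesis ed_unbalanced : forall s : 'I_n -> bool,
  exists u v b, ed u v b /\ b != s u (+) s v.

(** An edge whose class differs from [s u (+) s v] is added to the tree. The matrix for [false] is
    then T + N e, with e the matrix of this edge, and the matrix for [true] is conjugate by (-1)^s
    to T - N e. Their spectra are disjoint for a good weight N. *)
Lemma exists_disjoint_signed_spectra (u0 : 'I_n) : exists V w,
  [/\ forall i j b, w i j b = w j i b, forall i j b, ~~ ed i j b -> w i j b = 0
    & forall lambda (psi phi : 'rV[K]_n), psi != 0 -> phi != 0 ->
      psi *m signed_mx V w false = lambda *: psi ->
      phi *m signed_mx V w true = lambda *: phi -> False].
Proof.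
have [s [V [w gt]]] := exists_good_tree u0.
have [u [v [b [euv buv]]]] := ed_unbalanced s.
have sT := good_tree_sym gt; have [sw hw hV nz] := gt.
pose T := signed_mx V w false.
have [N N0 disj] : exists2 N : nat, N != 0 &
    forall lambda (psi phi : 'rV[K]_n), psi != 0 -> phi != 0 ->
      psi *m (T + N%:R *: edge_mx K u v) = lambda *: psi ->
      phi *m (T - N%:R *: edge_mx K u v) = lambda *: phi -> False.
  have [->|uv] := eqVneq u v.
    exists 1%N => // lambda psi phi; apply: closing_loop => //; exact: oner_neq0.
  have [bad badP] := closing_edge sT nz uv.
  (* The condition on the weight bears on its square, and the successor keeps it nonzero. *)
  have [|N Nbad] := @exists_image_notin _ (fun N => (N.+1)%:R ^+ 2 : K) bad.
    move=> x y /eqP; rewrite eqrXn2 ?ler0n // eqr_nat eqSS => /eqP //.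
  exists N.+1 => // lambda psi phi; apply: badP => //.
  by rewrite pnatr_eq0.
exists V, (fun i j c => w i j c + N * (joins u v i j && (c == b)))%N.
split=> [i j c|i j c|].
- by rewrite joins_sym sw.
- move=> neij; have -> : w i j c = 0.
    by apply/eqP; apply: contraNT neij => /hw /and4P[].
  suff /negPf-> : ~~ (joins u v i j && (c == b)) by rewrite muln0.
  apply: contra neij => /andP[/orP[] /andP[/eqP-> /eqP->] /eqP->] //.
  by rewrite ed_sym.
move=> lambda psi phi psi0 phi0 hpsi hphi.
pose sg i : K := (-1) ^+ (s i).
have sg2 i : sg i * sg i = 1 by rewrite /sg -expr2 sqrr_sign.
pose phi' : 'rV[K]_n := \row_i (phi 0 i * sg i).
have edgeE i j : edge_mx K u v i j = (joins u v i j)%:R by rewrite mxE.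
have e1 : signed_mx V (fun i j c => w i j c + N * (joins u v i j && (c == b)))%N false
    = T + N%:R *: edge_mx K u v.
  apply/matrixP => i j; rewrite [RHS]mxE [X in _ = _ + X]mxE edgeE !mxE.
  rewrite !natrD !natrM.
  rewrite expr0 !mul1r; case: b {euv buv hpsi hphi} => /=;
    rewrite ?andbT ?andbF /= ?mulr0n; ring.
have e2 i j : signed_mx V (fun i j c => w i j c + N * (joins u v i j && (c == b)))%N
    true i j = sg i * (T - N%:R *: edge_mx K u v) i j * sg j.
  rewrite [X in sg i * X]mxE [X in _ + X]mxE [X in _ - X]mxE edgeE !mxE.
  rewrite !natrD !natrM expr0 expr1 mul1r mulN1r.
  have sgb c : w i j c != 0 -> sg i * sg j = (-1) ^+ c.
    by move=> /hw /and4P[_ _ _ /eqP->]; rewrite signr_addb.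
  have wE c : sg i * sg j * (w i j c)%:R = (-1) ^+ c * (w i j c)%:R.
    have [->|/sgb->//] := eqVneq (w i j c) 0%N.
    by rewrite !mulr0.
  have VE : sg i * sg j * ((V i)%:R *+ (i == j)) = (V i)%:R *+ (i == j).
    by case: eqP => [->|_]; rewrite ?mulr0n ?mulr0 // sg2 mul1r.
  (* The new edge has the class opposite to the balanced one, hence the extra sign. *)
  have jE : sg i * sg j * (joins u v i j)%:R = - ((-1) ^+ b * (joins u v i j)%:R).
    case: (boolP (joins u v i j)) => [ij|_]; last by rewrite !mulr0 oppr0.
    have -> : sg i * sg j = (-1) ^+ (s u (+) s v).
      rewrite signr_addb; case/orP: ij => /andP[/eqP-> /eqP->] //.
      by rewrite mulrC.
    by move: buv; case: b {euv hpsi hphi e1}; case: (s u (+) s v) => //= _; ring.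
  have := wE true; have := wE false; move: jE; rewrite expr0 expr1 mul1r => jE w1 w2.
  transitivity (sg i * sg j * ((V i)%:R *+ (i == j)) + sg i * sg j * (w i j false)%:R
    + sg i * sg j * (w i j true)%:R - N%:R * (sg i * sg j * (joins u v i j)%:R)).
    rewrite VE w1 w2 jE.
    by case: b {euv buv hpsi hphi jE e1} => /=;
      rewrite ?andbT ?andbF ?expr0 ?expr1 /= ?mulr0n; ring.
  ring.
rewrite e1 in hpsi; apply: (disj lambda psi phi') => //.
  apply: contra_neq phi0 => /rowP p0; apply/rowP => i; have := p0 i.
  by rewrite !mxE => /(congr1 ( *%R^~ (sg i))); rewrite -mulrA sg2 mulr1 mul0r.
apply/rowP => j; move/rowP/(_ j): hphi; rewrite [LHS]mxE [RHS]mxE => h.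
rewrite [LHS]mxE [RHS]mxE [phi' 0 j]mxE mulrA -h mulr_suml.
apply: eq_bigr => i _; rewrite e2 [phi' 0 i]mxE.
by rewrite -!mulrA sg2 mulr1 !mulrA.
Qed.
End SignedGraph.

From mathcomp Require Import perm fraction complex separable polyrcf.
From mathcomp Require Import -(notations) mpoly.
From mathcomp Require Import all_classical all_analysis.
Import numFieldNormedType.Exports.
Local Open Scope classical_set_scope.
Local Open Scope ring_scope.

(** * Generic parameters *)

Lemma poly_ext (F : numFieldType) (u v : {poly F}) :
  (forall x, u.[x] = v.[x]) -> u = v.
Proof.
move=> uv; apply/eqP; rewrite -subr_eq0; apply/negPn/negP => uv0.
have := @max_poly_roots _ _ [seq i%:R | i <- iota 0 (size (u - v)%R)] uv0.
rewrite size_map size_iota ltnn => h; suff // : false by [].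
apply: h; first by apply/allP => x _; rewrite /root hornerD hornerN uv subrr.
rewrite map_inj_uniq ?iota_uniq // => x y /eqP.
by rewrite eqr_nat => /eqP.
Qed.

Section PolynomialFunctions.
Variables (R : realType) (d : nat) (Gamma : periodic_graph d).
Local Notation params := (parameters R Gamma).
Implicit Types (f g : params -> R) (p q : params).

Lemma polynomial_const (c : R) : polynomial_function (fun _ : params => c).
Proof.
by exists 0, (fun i : 'I_0 => False_rect _ (notF (ltn_ord i))), (mpolyC _ c) => p;
  rewrite mevalC.
Qed.

Lemma polynomial_coordinate t :
  polynomial_function (coordinate (R := R) (Gamma := Gamma) t).
Proof. by exists 1, (fun=> t), (mpolyX R (mnm1 ord0)) => p; rewrite mevalXU. Qed.

Lemma polynomial_common_variables f g :
  polynomial_function f -> polynomial_function g ->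
  exists N (t : 'I_N -> Gamma + Gamma * Gamma) P Q,
    (forall p, f p = meval (fun i => coordinate (t i) p) P) /\
    (forall p, g p = meval (fun i => coordinate (t i) p) Q).
Proof.
move=> [N1 [t1 [P1 hf]]] [N2 [t2 [P2 hg]]].
pose t (i : 'I_(N1 + N2)) := match fintype.split i with inl a => t1 a | inr b => t2 b end.
exists (N1 + N2)%N, t.
exists (comp_mpoly [tuple mpolyX R (mnm1 (lshift N2 i)) | i < N1] P1).
exists (comp_mpoly [tuple mpolyX R (mnm1 (rshift N1 i)) | i < N2] P2).
split=> p; rewrite ?hf ?hg comp_mpoly_meval; apply: meval_eq => i;
  rewrite tnth_mktuple mevalXU /t.
- by case: fintype.splitP => j /= ij; [congr (coordinate (t1 _) p); exact: val_inj|
    have := ltn_ord i; rewrite ij ltnNge leq_addr].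
- case: fintype.splitP => j /= ij; first by have := ltn_ord j;
    rewrite -ij ltnNge leq_addr.
  by congr (coordinate (t2 _) p); apply: val_inj; apply/(addnI ij).
Qed.

Lemma polynomial_add f g : polynomial_function f -> polynomial_function g ->
  polynomial_function (fun p => f p + g p).
Proof.
move=> hf hg; have [N [t [P [Q [fP gQ]]]]] := polynomial_common_variables hf hg.
by exists N, t, (P + Q) => p; rewrite fP gQ mevalD.
Qed.

Lemma polynomial_mul f g : polynomial_function f -> polynomial_function g ->
  polynomial_function (fun p => f p * g p).
Proof.
move=> hf hg; have [N [t [P [Q [fP gQ]]]]] := polynomial_common_variables hf hg.
by exists N, t, (P * Q) => p; rewrite fP gQ mevalM.
Qed.

Lemma polynomial_sum (I : Type) (r : seq I) (P : pred I) (F : I -> params -> R) :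
  (forall i, P i -> polynomial_function (F i)) ->
  polynomial_function (fun p => \sum_(i <- r | P i) F i p).
Proof.
move=> hF; elim: r => [|i r IH].
  rewrite (_ : (fun p => _) = fun=> 0); first exact: polynomial_const.
  by apply/funext => p; rewrite big_nil.
rewrite (_ : (fun p => _) = fun p => (if P i then F i p else 0)
   + \sum_(i <- r | P i) F i p); last first.
  by apply/funext => p; rewrite big_cons; case: ifP => // _; rewrite add0r.
apply: polynomial_add => //; case: (boolP (P i)) => [/hF//|_].
exact: polynomial_const.
Qed.

Lemma polynomial_prod (I : Type) (r : seq I) (P : pred I) (F : I -> params -> R) :
  (forall i, P i -> polynomial_function (F i)) ->
  polynomial_function (fun p => \prod_(i <- r | P i) F i p).
Proof.
move=> hF; elim: r => [|i r IH].
  rewrite (_ : (fun p => _) = fun=> 1); first exact: polynomial_const.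
  by apply/funext => p; rewrite big_nil.
rewrite (_ : (fun p => _) = fun p => (if P i then F i p else 1)
   * \prod_(i <- r | P i) F i p); last first.
  by apply/funext => p; rewrite big_cons; case: ifP => // _; rewrite mul1r.
apply: polynomial_mul => //; case: (boolP (P i)) => [/hF//|_].
exact: polynomial_const.
Qed.

Definition affine_line p q (s : R) : params.
Proof.
refine (@MkParams R d Gamma
  (fun v => potential p v + s * (potential q v - potential p v))
  (fun u v => edge_label p u v + s * (edge_label q u v - edge_label p u v)) _ _ _ _).
- by move=> a v; rewrite !potential_periodic.
- by move=> a u v; rewrite !edge_label_periodic.
- by move=> u v; rewrite (edge_label_sym p) (edge_label_sym q).
- by move=> u v uv; rewrite !edge_label_supp // subrr mulr0 addr0.
Defined.

Lemma params_ext p q :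
  potential p =1 potential q -> edge_label p =2 edge_label q -> p = q.
Proof.
case: p => Vp Ep p1 p2 p3 p4; case: q => Vq Eq q1 q2 q3 q4 /= /funext eV.
move=> eE2; have eE : Ep = Eq by apply/funext => u; apply/funext => v; exact: eE2.
clear eE2; rewrite eV eE in p1 p2 p3 p4 *.
by congr MkParams; exact: Prop_irrelevance.
Qed.

Lemma affine_line0 p q : affine_line p q 0 = p.
Proof. by apply: params_ext => [v|u v] /=; rewrite mul0r addr0. Qed.

Lemma affine_line1 p q : affine_line p q 1 = q.
Proof. by apply: params_ext => [v|u v] /=; ring. Qed.

Lemma coordinate_affine_line t p q s : coordinate t (affine_line p q s) =
  coordinate t p + s * (coordinate t q - coordinate t p).
Proof. by case: t. Qed.

Lemma polynomial_on_line f p q : polynomial_function f ->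
  exists u : {poly R}, forall s, f (affine_line p q s) = u.[s].
Proof.
move=> [N [t [P hf]]].
pose h i : {poly R} := (coordinate (t i) p)%:P +
  'X * (coordinate (t i) q - coordinate (t i) p)%:P.
exists (mmap polyC h P) => s; rewrite hf mevalE.
rewrite -/(horner_eval s _) /mmap rmorph_sum /=; apply: eq_bigr => m _.
rewrite rmorphM /= /horner_eval hornerC; congr (_ * _).
rewrite -/(horner_eval s _) /mmap1 rmorph_prod; apply: eq_bigr => i _.
rewrite rmorphXn /= /horner_eval /h !hornerE coordinate_affine_line.
by rewrite [s * _]mulrC // mulrC.
Qed.

(** The parameter space is irreducible: on the line through [p] and [q] both functions are nonzero
    polynomials in one variable, and so is their product. *)
Lemma polynomial_mul_nonzero f g p q :
  polynomial_function f -> polynomial_function g -> f p != 0 -> g q != 0 ->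
  exists r, f r * g r != 0.
Proof.
move=> hf hg fp gq.
have [u hu] := polynomial_on_line p q hf; have [v hv] := polynomial_on_line p q hg.
have uv0 : u * v != 0.
  rewrite mulf_neq0 //; apply/eqP => e0.
    by move: fp; rewrite -(affine_line0 p q) hu e0 horner0 eqxx.
  by move: gq; rewrite -(affine_line1 p q) hv e0 horner0 eqxx.
have : ~ (forall s, (u * v).[s] = 0).
  by move=> h0; case/eqP: uv0; apply: poly_ext => s; rewrite h0 horner0.
move=> /existsNP[s /eqP hs]; exists (affine_line p q s).
by rewrite hu hv -hornerM.
Qed.

(** Of the equations of a proper algebraic subset, a single one that is not identically zero is
    kept; its zero set may be larger but is still proper. *)
Lemma genericP (P : params -> Prop) : generic P <->
  exists f, [/\ polynomial_function f, exists p, f p != 0 &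
    forall p, f p != 0 -> P p].
Proof.
split=> [[S [[F [Fpoly SE]] ST SP]]|[f [hf [p0 fp0] fP]]].
  have [p0 Sp0] : exists p, ~ S p.
    by apply/existsNP => allS; apply: ST; apply/seteqP; split.
  have [f Ff fp0] : exists2 f, F f & f p0 != 0.
    move: Sp0; rewrite SE => /existsNP[f /not_implyP[Ff /eqP fp0]].
    by exists f.
  exists f; split; [exact: Fpoly|by exists p0|].
  by move=> p fp; apply: SP; rewrite SE => /(_ f Ff) /eqP; rewrite (negPf fp).
exists [set p | f p = 0]; split.
- exists [set f]; split; first by move=> _ ->.
  by apply/seteqP; split=> [p /= fp _ ->//|p /= /(_ f)]; apply.
- by move=> /seteqP[_ /(_ p0 I)] /= /eqP; rewrite (negPf fp0).
- by move=> p /eqP; apply: fP.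
Qed.

Lemma generic_and (P Q : params -> Prop) :
  generic P -> generic Q -> generic (fun p => P p /\ Q p).
Proof.
move=> /genericP[f [hf [p fp] fP]] /genericP[g [hg [q gq] gQ]].
apply/genericP; exists (fun p => f p * g p); split.
- exact: polynomial_mul.
- exact: polynomial_mul_nonzero fp gq.
- by move=> r; rewrite mulf_eq0 negb_or => /andP[/fP ? /gQ ?].
Qed.

Lemma generic_sub (P Q : params -> Prop) :
  (forall p, P p -> Q p) -> generic P -> generic Q.
Proof. by move=> PQ [S [aS ST SP]]; exists S; split=> // p /SP /PQ. Qed.

Definition null_params : params.
Proof. by refine (@MkParams R d Gamma (fun=> 0) (fun _ _ => 0) _ _ _ _). Defined.

Lemma generic_true (P : params -> Prop) : (forall p, P p) -> generic P.
Proof.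
move=> allP; apply/genericP; exists (fun=> 1); split=> //.
- exact: polynomial_const.
- by exists null_params; rewrite oner_neq0.
Qed.

Lemma generic_forall (I : finType) (P : I -> params -> Prop) :
  (forall i, generic (P i)) -> generic (fun p => forall i, P i p).
Proof.
move=> gP; suff : generic (fun p => forall i, i \in enum I -> P i p).
  by apply: generic_sub => p h i; apply: h; rewrite mem_enum.
elim: (enum I) => [|i s IH]; first exact: generic_true.
apply: generic_sub (generic_and (gP i) IH) => p [Pi Ps] j.
by rewrite in_cons => /predU1P[->|/Ps].
Qed.
End PolynomialFunctions.

(** * The Floquet matrix *)

Section FloquetMatrix.
Variables (R : realType) (d : nat) (Gamma : periodic_graph d).
Variables (n : nat) (W : 'I_n -> Gamma).
Implicit Types (a b : 'rV[int]_d) (p : parameters R Gamma).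

Lemma translate_inj (v : Gamma) : injective (fun a => translate a v).
Proof.
move=> a b ab; apply/eqP; rewrite -subr_eq0; apply/eqP.
apply: (@translate_free _ _ _ (translate b v)).
by rewrite -translateD subrK.
Qed.

Definition hops i j : set 'rV[int]_d := [set a | adj (W i) (translate a (W j))].

(** Up to translation the edge from [W i] to [translate a (W j)] is one of finitely many pairs, and
    freeness recovers [a] from the pair. *)
Lemma finite_hops i j : finite_set (hops i j).
Proof.
have [F [finF coverF]] := edge_cocompact Gamma.
(* By freeness at most one hop comes from [e]; 0 is the default when there is none. *)
pose g (e : Gamma * Gamma) : 'rV[int]_d := xget 0 [set a | exists b,
  W i = translate b e.1 /\ translate a (W j) = translate b e.2].
apply: sub_finite_set (finite_image g finF) => a /= /coverF[b [e [Fe [e1 e2]]]].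
exists e => //; apply: xget_unique; first by exists b.
move=> a' [b' [e1' e2']]; apply: (@translate_inj (W j)).
rewrite e2 e2'; congr translate; apply: (@translate_inj e.1).
by rewrite /= -e1 -e1'.
Qed.

Definition hop_seq i j : seq 'rV[int]_d := finmap.enum_fset (fset_set (hops i j)).

Lemma hopsN i j a : hops i j a -> hops j i (- a).
Proof.
rewrite /hops /= => h; rewrite adj_sym -(adj_translate a) -translateD subrr.
by rewrite translate0.
Qed.

Lemma monomialN (K : fieldType) (z : 'I_d -> K) a :
  monomial (fun k => (z k)^-1) (- a) = monomial z a.
Proof.
apply: eq_bigr => k _; rewrite mxE.
by rewrite exprz_inv opprK.
Qed.

Lemma FloquetE (K : fieldType) (iota : {rmorphism R -> K}) (z : 'I_d -> K) p i j :
  Floquet W iota z p i j = iota (potential p (W i)) *+ (i == j) +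
    \sum_(a <- hop_seq i j)
      iota (edge_label p (W i) (translate a (W j))) * monomial z a.
Proof. by rewrite mxE fsbig_finite //; exact: finite_hops. Qed.

(** Reversing an edge replaces the hop [a] by [- a] and keeps its label. *)
Lemma Floquet_tr (K : fieldType) (iota : {rmorphism R -> K}) (z : 'I_d -> K) p :
  (Floquet W iota z p)^T = Floquet W iota (fun k => (z k)^-1) p.
Proof.
apply/matrixP => i j; rewrite !mxE eq_sym; congr (_ + _).
  by case: eqP => // ->.
rewrite (reindex_fsbig (fun a => - a) (hops i j)); last first.
  split=> [a|x y _ _|a]; [exact: hopsN|exact: oppr_inj|].
  by move=> /hopsN h; exists (- a); rewrite ?opprK.
apply: eq_fsbigr => a _; congr (iota _ * _).
  rewrite edge_label_sym -(edge_label_periodic _ a) -translateD subrr translate0.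
  by [].
by rewrite -[a in RHS]opprK monomialN.
Qed.

Lemma map_Floquet (K L : fieldType) (f : {rmorphism K -> L})
    (iota : {rmorphism R -> K}) (iota' : {rmorphism R -> L})
    (z : 'I_d -> K) (z' : 'I_d -> L) p :
  (forall x, f (iota x) = iota' x) -> (forall k, f (z k) = z' k) ->
  map_mx f (Floquet W iota z p) = Floquet W iota' z' p.
Proof.
move=> fi fz; apply/matrixP => i j; rewrite mxE !FloquetE rmorphD rmorphMn fi.
rewrite rmorph_sum; congr (_ + _); apply: eq_bigr => a _.
rewrite rmorphM fi /monomial rmorph_prod; congr (_ * _); apply: eq_bigr => k _.
by rewrite fmorphXz fz.
Qed.

Definition polynomial_matrix m l (M : parameters R Gamma -> 'M[R]_(m, l)) :=
  forall (i : 'I_m) (j : 'I_l), polynomial_function (fun p => M p i j).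

Definition polynomial_coefs (q : parameters R Gamma -> {poly R}) :=
  forall k, polynomial_function (fun p => (q p)`_k).

Lemma polynomial_Floquet (z : 'I_d -> R) :
  polynomial_matrix (Floquet W (idfun : {rmorphism R -> R}) z).
Proof.
move=> i j; rewrite (_ : (fun p => _) = fun p => (coordinate (inl (W i)) p) * (i == j)%:R
   + \sum_(a <- hop_seq i j)
      coordinate (inr (W i, translate a (W j))) p * monomial z a).
  apply: polynomial_add.
    by apply: polynomial_mul; [exact: polynomial_coordinate|exact: polynomial_const].
  apply: polynomial_sum => a _; apply: polynomial_mul.
    exact: polynomial_coordinate.
  exact: polynomial_const.
by apply/funext => p; rewrite FloquetE /= mulr_natr.
Qed.

Lemma polynomial_mulmx m l r (M : parameters R Gamma -> 'M[R]_(m, l))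
    (N : parameters R Gamma -> 'M[R]_(l, r)) :
  polynomial_matrix M -> polynomial_matrix N ->
  polynomial_matrix (fun p => M p *m N p).
Proof.
move=> hM hN i j; rewrite (_ : (fun p => _) = fun p => \sum_k M p i k * N p k j).
  by apply: polynomial_sum => k _; apply: polynomial_mul.
by apply/funext => p; rewrite mxE.
Qed.

Lemma polynomial_det m (M : parameters R Gamma -> 'M[R]_m) :
  polynomial_matrix M -> polynomial_function (fun p => \det (M p)).
Proof.
move=> hM; apply: polynomial_sum => s _; apply: polynomial_mul.
  exact: polynomial_const.
by apply: polynomial_prod.
Qed.

Lemma polynomial_coefs_add q r : polynomial_coefs q -> polynomial_coefs r ->
  polynomial_coefs (fun p => q p + r p).
Proof.
move=> hq hr k; rewrite (_ : (fun p => _) = fun p => (q p)`_k + (r p)`_k).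
  exact: polynomial_add.
by apply/funext => p; rewrite coefD.
Qed.

Lemma polynomial_coefs_mul q r : polynomial_coefs q -> polynomial_coefs r ->
  polynomial_coefs (fun p => q p * r p).
Proof.
move=> hq hr k.
rewrite (_ : (fun p => _) = fun p => \sum_(i < k.+1) (q p)`_i * (r p)`_(k - i)).
  by apply: polynomial_sum => i _; apply: polynomial_mul.
by apply/funext => p; rewrite coefM.
Qed.

Lemma polynomial_coefs_const (q : {poly R}) : polynomial_coefs (fun=> q).
Proof. by move=> k; apply: polynomial_const. Qed.

Lemma polynomial_char_poly m (M : parameters R Gamma -> 'M[R]_m) :
  polynomial_matrix M -> polynomial_coefs (fun p => char_poly (M p)).
Proof.
move=> hM.
pose F (s : 'S_m) (p : parameters R Gamma) : {poly R} :=
  (-1) ^+ s * \prod_i char_poly_mx (M p) i (s i).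
have bigsum (I : Type) (r : seq I) (G : I -> parameters R Gamma -> {poly R}) :
    (forall i, polynomial_coefs (G i)) -> polynomial_coefs (fun p => \sum_(i <- r) G i p).
  move=> hG; elim: r => [|i r IH].
    rewrite (_ : (fun p => _) = fun=> 0); first exact: polynomial_coefs_const.
    by apply/funext => p; rewrite big_nil.
  rewrite (_ : (fun p => _) = fun p => G i p + \sum_(i <- r) G i p).
    exact: polynomial_coefs_add.
  by apply/funext => p; rewrite big_cons.
have bigprod (I : Type) (r : seq I) (G : I -> parameters R Gamma -> {poly R}) :
    (forall i, polynomial_coefs (G i)) ->
    polynomial_coefs (fun p => \prod_(i <- r) G i p).
  move=> hG; elim: r => [|i r IH].
    rewrite (_ : (fun p => _) = fun=> 1); first exact: polynomial_coefs_const.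
    by apply/funext => p; rewrite big_nil.
  rewrite (_ : (fun p => _) = fun p => G i p * \prod_(i <- r) G i p).
    exact: polynomial_coefs_mul.
  by apply/funext => p; rewrite big_cons.
apply: (bigsum _ _ F) => s; apply: polynomial_coefs_mul.
  exact: polynomial_coefs_const.
apply: bigprod => i k.
rewrite (_ : (fun p => _) = fun p => ('X *+ (i == s i) : {poly R})`_k
   + (k == 0%N)%:R * (- 1) * M p i (s i)).
  apply: polynomial_add; first exact: polynomial_const.
  by apply: polynomial_mul => //; exact: polynomial_const.
apply/funext => p; rewrite !mxE coefB coefC.
by case: (k == 0%N); rewrite /= ?mulr1n ?mulr0n ?mul1r ?mul0r ?mulN1r ?subr0 ?addr0.
Qed.

(** The bound [N], uniform in [p], makes the evaluation a sum of fixed length. *)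
Lemma polynomial_horner_mx m (M : parameters R Gamma -> 'M[R]_m.+1)
    (q : parameters R Gamma -> {poly R}) N :
  (forall p, (size (q p) <= N)%N) ->
  polynomial_matrix M -> polynomial_coefs q ->
  polynomial_matrix (fun p => horner_mx (M p) (q p)).
Proof.
move=> sq hM hq i j.
rewrite (_ : (fun p => _) = fun p => \sum_(k < N) (q p)`_k * (M p ^+ k) i j).
  apply: polynomial_sum => k _; apply: polynomial_mul => //.
  elim: (nat_of_ord k) i j => [|l IH] i j; first exact: polynomial_const.
  rewrite (_ : (fun p => _) = fun p => (M p *m M p ^+ l) i j).
    exact: (polynomial_mulmx hM IH).
  by apply/funext => p; rewrite exprS.
apply/funext => p; rewrite -{1}[q p](take_poly_id (sq p)) /take_poly poly_def.
rewrite rmorph_sum summxE; apply: eq_bigr => k _.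
by rewrite /= horner_mxZ rmorphXn /= horner_mx_X mxE.
Qed.
End FloquetMatrix.

(** A Bezout relation u chi_A + v q = 1 evaluated at A gives v(A) q(A) = 1 by Cayley-Hamilton. The
    determinant of q(A) serves as the resultant of chi_A and q: it is polynomial in the entries of A
    and the coefficients of q. *)
Lemma det_horner_mx_neq0 (F : fieldType) m (A : 'M[F]_m.+1) q :
  coprimep (char_poly A) q -> \det (horner_mx A q) != 0.
Proof.
move=> /Bezout_eq1_coprimepP[[u v] /= uv].
have : horner_mx A v *m horner_mx A q = 1%:M.
  have := congr1 (horner_mx A) uv.
  by rewrite rmorphD !rmorphM rmorph1 /= Cayley_Hamilton mulr0 add0r.
by move=> /mulmx1_unit[_]; rewrite unitmxE unitfE.
Qed.

(** An eigenvector of [A] for [x] is killed by q(A), because X - x divides q. *)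
Lemma det_horner_mx_common_root (F : fieldType) m (A : 'M[F]_m.+1) q x :
  root (char_poly A) x -> root q x -> \det (horner_mx A q) = 0.
Proof.
rewrite -eigenvalue_root_char => /eigenvalueP[v vA v0] /factor_theorem[r ->].
apply/eqP/det0P; exists v => //.
rewrite mulrC rmorphM /= rmorphB /= horner_mx_X horner_mx_C.
rewrite -[_ * _]/(_ *m _) mulmxA.
by rewrite mulmxBr vA mul_mx_scalar subrr mul0mx.
Qed.

Lemma horner_affine_pair (F : fieldType) (q r : {poly F}) (a b x : F) :
  (q * a%:P + r * b%:P).[x] = q.[x] * a + r.[x] * b.
Proof. by rewrite !hornerE. Qed.

(** * Evaluation of the dispersion polynomial at a point *)

Section Evaluation.
Variables (R : realType) (d : nat) (K : fieldType).
Variables (iota : {rmorphism R -> K}) (z : 'I_d -> K).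
Hypothesis z_neq0 : forall k, z k != 0.

(* Evaluation at z is a partial function of rational functions, hence a relation. *)
Definition has_value (x : ratfun R d) (y : K) := exists P Q : mpoly d R,
  [/\ x * tofrac Q = tofrac P, y * mmap iota z Q = mmap iota z P
    & mmap iota z Q != 0].

Lemma has_value_unique x y y' : has_value x y -> has_value x y' -> y = y'.
Proof.
move=> [P [Q [e1 e2 q0]]] [P' [Q' [e1' e2' q0']]].
have e : P * Q' = P' * Q.
  by apply/eqP; rewrite -tofrac_eq !rmorphM /= -e1 -e1' mulrAC.
apply: (mulIf (mulf_neq0 q0 q0')).
rewrite mulrA e2 [mmap _ _ Q * _]mulrC mulrA e2'.
by rewrite -!rmorphM /= e.
Qed.

Lemma has_value_const c : has_value (ratfunC R d c) (iota c).
Proof.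
exists (mpolyC d c), 1; split; rewrite ?rmorph1 ?mulr1 ?oner_neq0 //.
by rewrite mmapC.
Qed.

Lemma has_valueD x x' y y' :
  has_value x y -> has_value x' y' -> has_value (x + x') (y + y').
Proof.
move=> [P [Q [e1 e2 q0]]] [P' [Q' [e1' e2' q0']]].
exists (P * Q' + P' * Q), (Q * Q'); split.
- by rewrite rmorphM rmorphD !rmorphM /= -e1 -e1'; ring.
- by rewrite rmorphM rmorphD !rmorphM /= -e2 -e2'; ring.
- by rewrite rmorphM mulf_neq0.
Qed.

Lemma has_valueM x x' y y' :
  has_value x y -> has_value x' y' -> has_value (x * x') (y * y').
Proof.
move=> [P [Q [e1 e2 q0]]] [P' [Q' [e1' e2' q0']]].
exists (P * P'), (Q * Q'); split.
- by rewrite !rmorphM /= -e1 -e1'; ring.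
- by rewrite !rmorphM /= -e2 -e2'; ring.
- by rewrite rmorphM mulf_neq0.
Qed.

Lemma has_value1 : has_value 1 1.
Proof. by have := has_value_const 1; rewrite !rmorph1. Qed.

Lemma has_value0 : has_value 0 0.
Proof. by have := has_value_const 0; rewrite !rmorph0. Qed.

Lemma has_valueN x y : has_value x y -> has_value (- x) (- y).
Proof.
move=> [P [Q [e1 e2 q0]]]; exists (- P), Q.
by rewrite !rmorphN /= !mulNr e1 e2.
Qed.

Lemma has_valueX x y m : has_value x y -> has_value (x ^+ m) (y ^+ m).
Proof.
move=> xy; elim: m => [|m IH]; first exact: has_value1.
by rewrite !exprS; apply: has_valueM.
Qed.

Lemma has_value_sum (I : Type) (r : seq I) (P : pred I) (F : I -> ratfun R d)
    (G : I -> K) : (forall i, P i -> has_value (F i) (G i)) ->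
  has_value (\sum_(i <- r | P i) F i) (\sum_(i <- r | P i) G i).
Proof.
move=> FG; apply: (big_ind2 has_value) => //; first exact: has_value0.
by move=> *; apply: has_valueD.
Qed.

Lemma has_value_prod (I : Type) (r : seq I) (P : pred I) (F : I -> ratfun R d)
    (G : I -> K) : (forall i, P i -> has_value (F i) (G i)) ->
  has_value (\prod_(i <- r | P i) F i) (\prod_(i <- r | P i) G i).
Proof.
move=> FG; apply: (big_ind2 has_value) => //; first exact: has_value1.
by move=> *; apply: has_valueM.
Qed.

Lemma has_value_det m (A : 'M[ratfun R d]_m) (B : 'M[K]_m) :
  (forall i j, has_value (A i j) (B i j)) -> has_value (\det A) (\det B).
Proof.
move=> AB; apply: has_value_sum => s _; apply: has_valueM.
  by apply: has_valueX; apply: has_valueN; exact: has_value1.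
by apply: has_value_prod.
Qed.

Lemma has_value_indeterminate k : has_value (indeterminate R k) (z k).
Proof.
exists (mpolyX R (mnm1 k)), 1; split; rewrite ?rmorph1 ?mulr1 ?oner_neq0 //.
by rewrite mmapX mmap1U.
Qed.

Lemma has_valueV k : has_value (indeterminate R k)^-1 (z k)^-1.
Proof.
have eX : mmap iota z (mpolyX R (mnm1 k)) = z k by rewrite mmapX mmap1U.
exists 1, (mpolyX R (mnm1 k)); split; rewrite ?eX ?rmorph1 ?mulVf //.
by rewrite tofrac_eq0; apply: contra_neq (z_neq0 k); rewrite -eX => ->; rewrite rmorph0.
Qed.

Lemma has_value_monomial a :
  has_value (monomial (@indeterminate R d) a) (monomial z a).
Proof.
apply: has_value_prod => k _; case: (a 0 k) => m.
  exact/has_valueX/has_value_indeterminate.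
rewrite !NegzE -!exprz_inv; exact/has_valueX/has_valueV.
Qed.

Variables (Gamma : periodic_graph d) (n : nat) (W : 'I_n -> Gamma).
Variable p : parameters R Gamma.

Lemma has_value_Floquet i j :
  has_value (Floquet W (ratfunC R d) (@indeterminate R d) p i j)
    (Floquet W iota z p i j).
Proof.
rewrite !FloquetE; apply: has_valueD.
  by case: (i == j); [exact: has_value_const|exact: has_value0].
apply: has_value_sum => a _; apply: has_valueM; first exact: has_value_const.
exact: has_value_monomial.
Qed.

(** Both sides are values at [z] of one rational function, the dispersion polynomial at [lambda],
    and a value is unique. *)
Lemma sparse_dispersion_value (c0 : {poly R}) (cp cm : 'I_d -> {poly R}) lambda :
  dispersion_poly W p = map_poly (ratfunC R d) c0 +
    \sum_(k < d) (map_poly (ratfunC R d) (cp k) * (indeterminate R k)%:P +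
                  map_poly (ratfunC R d) (cm k) * ((indeterminate R k)^-1)%:P) ->
  \det (Floquet W iota z p - (iota lambda)%:M) = iota c0.[lambda] +
    \sum_(k < d) (iota (cp k).[lambda] * z k + iota (cm k).[lambda] / z k).
Proof.
move=> /(congr1 (horner_eval (ratfunC R d lambda))).
rewrite /dispersion_poly -det_map_mx /horner_eval hornerD horner_sum => eqD.
apply: (@has_value_unique (\det (Floquet W (ratfunC R d) (@indeterminate R d) p
   - (ratfunC R d lambda)%:M))).
  apply: has_value_det => i j; rewrite !mxE.
  apply: has_valueD; first by have := has_value_Floquet i j; rewrite !mxE.
  apply: has_valueN; case: (i == j); last exact: has_value0.
  exact: has_value_const.
have -> : Floquet W (ratfunC R d) (@indeterminate R d) p - (ratfunC R d lambda)%:M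
   = map_mx (horner_eval (ratfunC R d lambda))
      (map_mx polyC (Floquet W (ratfunC R d) (@indeterminate R d) p) - 'X%:M).
  apply/matrixP => i j; rewrite !mxE /= /horner_eval hornerD hornerN hornerMn.
  by rewrite hornerC hornerX.
rewrite eqD; apply: has_valueD.
  by rewrite horner_map; exact: has_value_const.
apply: has_value_sum => k _.
rewrite horner_affine_pair 2!horner_map.
apply: has_valueD; apply: has_valueM; try exact: has_value_const.
  exact: has_value_indeterminate.
exact: has_valueV.
Qed.
End Evaluation.

Section TorusDispersion.
Variables (R : realType) (d : nat) (Gamma : periodic_graph d).
Variables (n : nat) (W : 'I_n -> Gamma) (p : parameters R Gamma).
Local Notation emb := (complex_embedding R).
Local Notation Re := (@complex.Re R).

Lemma unit_complex_inv (x : R[i]) : `|x| = 1 -> x^-1 = conjc x.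
Proof. by move=> x1; rewrite invc_norm x1 expr1n invr1 mul1r. Qed.

(** By transposition the determinant is the same at z and 1/z. The mean of the two expansions has
    the symmetric terms (c_+ + c_-)(z_k + 1/z_k)/2, and z_k + 1/z_k = 2 Re z_k on the torus. *)
Lemma sparse_dispersion_torus : minimally_sparse_poly (dispersion_poly W p) ->
  exists (c0 : {poly R}) (c : 'I_d -> {poly R}), forall (z : 'I_d -> R[i]) lambda,
    (forall k, `|z k| = 1) ->
    \det (Floquet W emb z p - (emb lambda)%:M) =
    emb (c0.[lambda] + \sum_k (c k).[lambda] * Re (z k)).
Proof.
move=> [c0 [cp [cm eqD]]]; exists c0, (fun k => cp k + cm k) => z lambda z1.
have z0 k : z k != 0 by rewrite -normr_eq0 z1 oner_neq0.
have z0' k : (z k)^-1 != 0 by rewrite invr_eq0.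
have D1 := sparse_dispersion_value emb z0 lambda eqD.
have D2 := sparse_dispersion_value emb z0' lambda eqD.
have eqdet : \det (Floquet W emb (fun k => (z k)^-1) p - (emb lambda)%:M) =
    \det (Floquet W emb z p - (emb lambda)%:M).
  have zVV : (fun k => ((z k)^-1)^-1) = z by apply/funext => k; rewrite invrK.
  by rewrite -[LHS]det_tr raddfB /= tr_scalar_mx Floquet_tr zVV.
have two0 : 2%:R != 0 :> R[i] by rewrite pnatr_eq0.
have half_sum (x y a b : R[i]) : x = a -> y = b -> y = x -> x * 2 = a + b.
  by move=> <- <- ->; rewrite mulr_natr mulr2n.
apply: (mulIf two0); rewrite (half_sum _ _ _ _ D1 D2 eqdet).
rewrite addrACA -big_split /=.
rewrite rmorphD rmorph_sum mulrDl.
congr (_ + _).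
  by rewrite mulr_natr mulr2n.
rewrite mulr_suml; apply: eq_bigr => k _.
have zJ := unit_complex_inv (z1 k).
have -> : emb ((cp k + cm k).[lambda] * Re (z k)) * 2 =
    emb (cp k + cm k).[lambda] * (z k + (z k)^-1).
  by rewrite zJ addcJ rmorphM /=; ring.
by rewrite hornerD rmorphD /= invrK; ring.
Qed.
End TorusDispersion.

(** * Parities of translations and the points of {+-1}^d *)

Section Parity.
Variables (d : nat) (k : 'I_d).
Implicit Types (a b : 'rV[int]_d).

Definition parity a : bool := odd `|a 0%R k|%N.

Lemma parityD a b : parity (a + b) = parity a (+) parity b.
Proof. by rewrite /parity mxE; move: (a 0 k) (b 0 k) => x y; lia. Qed.

Lemma parityN a : parity (- a) = parity a.
Proof. by rewrite /parity mxE abszN. Qed.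

Lemma parity_delta : parity (delta_mx 0 k) = true.
Proof. by rewrite /parity mxE !eqxx. Qed.

Lemma signr_exprz (R : numFieldType) (x : int) : (-1) ^ x = (-1) ^+ odd `|x|%N :> R.
Proof.
case: x => m; first by rewrite -exprnP signr_odd.
rewrite NegzE -exprnN abszN absz_nat signr_odd.
by rewrite -exprVn invrN1.
Qed.
End Parity.

Section SignPoints.
Variables (R : realType) (d : nat).
Implicit Types (e : {ffun 'I_d -> bool}) (a : 'rV[int]_d).

(** The points of {+-1}^d are indexed by a finite type, so that the generic conditions at all of
    them can be intersected. *)
Definition sign_point e (k : 'I_d) : R := (-1) ^+ e k.

Definition flip (k : 'I_d) e : {ffun 'I_d -> bool} := [ffun l => e l (+) (l == k)].

Lemma sign_pointV e : (fun k => (sign_point e k)^-1) = sign_point e.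
Proof.
by apply/funext => k; rewrite /sign_point; case: (e k); rewrite ?invrN1 ?invr1.
Qed.

Lemma monomial_sign_pointN e a :
  monomial (sign_point e) (- a) = monomial (sign_point e) a.
Proof. by rewrite -{1}sign_pointV monomialN. Qed.

Lemma monomial_sign_point_sq e a :
  monomial (sign_point e) a * monomial (sign_point e) a = 1.
Proof.
rewrite -big_split big1 //= => k _; rewrite -exprzMl ?unitfE ?signr_eq0 //.
by rewrite /sign_point -expr2 sqrr_sign exp1rz.
Qed.

Lemma monomial_flip k e a :
  monomial (sign_point (flip k e)) a = monomial (sign_point e) a * (-1) ^+ parity k a.
Proof.
rewrite /monomial (eq_bigr (fun l => sign_point e l ^ a 0 l * (-1) ^+ (l == k) ^ a 0 l)).
  rewrite big_split /=; congr (_ * _); rewrite (bigD1 k) //= eqxx expr1 big1.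
    by rewrite mulr1 signr_exprz.
  by move=> l /negPf ->; rewrite expr0 exp1rz.
move=> l _; rewrite /sign_point ffunE signr_addb exprzMl // unitfE signr_eq0 //.
Qed.
End SignPoints.

Section CommonRoots.
Variable R : realType.
Local Notation emb := (complex_embedding R).

(** A nonconstant common factor over the reals has a complex root, an eigenvalue of both
    matrices. *)
Lemma coprime_char_poly n (A B : 'M[R]_n) :
  (forall lambda (psi phi : 'rV[R[i]]_n), psi != 0 -> phi != 0 ->
     psi *m map_mx emb A = lambda *: psi -> phi *m map_mx emb B = lambda *: phi ->
     False) ->
  coprimep (char_poly A) (char_poly B).
Proof.
move=> disj; apply/negPn/negP => ncop.
have g0 : gcdp (char_poly A) (char_poly B) != 0.
  by rewrite gcdp_eq0 negb_and monic_neq0 ?char_poly_monic.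
have : size (map_poly emb (gcdp (char_poly A) (char_poly B))) != 1%N.
  by rewrite size_map_poly.
move=> /closed_rootP[x rx].
have eig (M : 'M[R]_n) : gcdp (char_poly A) (char_poly B) %| char_poly M ->
    exists2 v : 'rV[R[i]]_n, v *m map_mx emb M = x *: v & v != 0.
  move=> dv; apply/eigenvalueP; rewrite eigenvalue_root_char -map_char_poly.
  by apply: root_dvdp rx; rewrite dvdp_map.
have [psi epsi psi0] := eig A (dvdp_gcdl _ _).
have [phi ephi phi0] := eig B (dvdp_gcdr _ _).
exact: disj psi0 phi0 epsi ephi.
Qed.
End CommonRoots.

(** * Parameters that realise a signed graph *)

Section ExistenceOfParameters.
Variables (R : realType) (d : nat) (Gamma : periodic_graph d).
Variables (n : nat) (W : 'I_n -> Gamma).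
Hypothesis repW : orbit_representatives W.
Hypothesis connGamma : connected_graph Gamma.
Local Notation emb := (complex_embedding R).
Implicit Types (e : {ffun 'I_d -> bool}).

(** At a point of {+-1}^d the Floquet matrix is real; over [R] its entries are polynomial functions
    of the parameters. *)
Definition sign_Floquet e (p : parameters R Gamma) : 'M[R]_n :=
  Floquet W (idfun : {rmorphism R -> R}) (@sign_point R d e) p.

Lemma exists_coordinates : exists (ind : Gamma -> 'I_n) (shift : Gamma -> 'rV[int]_d),
  [/\ forall v, v = translate (shift v) (W (ind v)),
      forall a v, ind (translate a v) = ind v,
      forall a v, shift (translate a v) = a + shift v
    & forall i, ind (W i) = i /\ shift (W i) = 0].
Proof.
have /choice[g gP] : forall v, exists ia : 'I_n * 'rV[int]_d, v = translate ia.2 (W ia.1).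
  by move=> v; have [ia [h _]] := repW v; exists ia.
have gU a i : g (translate a (W i)) = (i, a).
  have [ia [h hu]] := repW (translate a (W i)).
  by rewrite -(hu (i, a)) // -(hu (g (translate a (W i)))).
have gT a v : g (translate a v) = ((g v).1, a + (g v).2).
  by rewrite [in LHS](gP v) -translateD gU.
exists (fun v => (g v).1), (fun v => (g v).2); split=> //.
- by move=> a v; rewrite gT.
- by move=> a v; rewrite gT.
- by move=> i; rewrite -[W i]translate0 gU.
Qed.

Variables (ind : Gamma -> 'I_n) (shift : Gamma -> 'rV[int]_d).
Hypothesis coordE : forall v, v = translate (shift v) (W (ind v)).
Hypothesis indT : forall a v, ind (translate a v) = ind v.
Hypothesis shiftT : forall a v, shift (translate a v) = a + shift v.
Hypothesis ind_rep : forall i, ind (W i) = i.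
Hypothesis shift_rep : forall i, shift (W i) = 0.

Lemma adj_hops u v : adj u v -> hops W (ind u) (ind v) (shift v - shift u).
Proof.
rewrite {1}(coordE u) {1}(coordE v) /hops /= => h.
by rewrite -(adj_translate (shift u)) -translateD addrC subrK.
Qed.

Lemma mem_hop_seq i j a : (a \in hop_seq W i j) = (a \in hops W i j).
Proof. by rewrite /hop_seq in_fset_set //; exact: finite_hops. Qed.

Lemma hop_seq_opp i j : perm_eq (hop_seq W j i) (map -%R (hop_seq W i j)).
Proof.
apply: uniq_perm; first exact: finmap.fset_uniq.
  by rewrite map_inj_uniq ?finmap.fset_uniq //; exact: oppr_inj.
move=> a; apply/idP/mapP => [|[b]]; rewrite !mem_hop_seq !inE.
  move=> h; exists (- a); last by rewrite opprK.
  by rewrite mem_hop_seq inE; exact: hopsN.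
by move=> h ->; exact: hopsN.
Qed.

Section OneVariable.
Variable k : 'I_d.

(** Edges of the quotient graph, classed by the parity of their displacement in direction [k]: the
    terms of the odd ones change sign under [flip k]. *)
Definition signed_edge i j (b : bool) := has (fun a => parity k a == b) (hop_seq W i j).

Lemma signed_edgeP i j b :
  signed_edge i j b <-> exists2 a, hops W i j a & parity k a = b.
Proof.
split=> [/hasP[a]|[a ha pa]]; first by rewrite mem_hop_seq inE => ha /eqP; exists a.
by apply/hasP; exists a; rewrite ?mem_hop_seq ?inE ?pa.
Qed.

Lemma signed_edge_sym i j b : signed_edge i j b = signed_edge j i b.
Proof.
by apply/idP/idP => /signed_edgeP[a ha pa]; apply/signed_edgeP; exists (- a);
  rewrite ?parityN //; exact: hopsN.
Qed.

(** A path in [Gamma] from [W u] to [W v] has a first edge that leaves the orbits of [S]. *)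
Lemma signed_edge_connected (S : {set 'I_n}) : S != finset.set0 -> S != finset.setT ->
  exists u v b, [/\ u \in S, v \notin S & signed_edge u v b].
Proof.
move=> /set0Pn[u uS] S1.
have [v vS] : exists v, v \notin S.
  apply: contrapT => hS; case/eqP: S1; apply/setP => v; rewrite finset.in_setT.
  by apply/negPn/negP => vS; apply: hS; exists v.
have [s [ps ls]] := connGamma (W u) (W v).
have : ind (W u) \in S by rewrite ind_rep.
have : ind (last (W u) s) \notin S by rewrite ls ind_rep.
elim: s (W u) ps {ls} => [|y s IH] x /=; first by move=> _ /negP.
move=> /andP[xy ps] lS xS.
have [yS|yS] := boolP (ind y \in S); first exact: IH ps lS yS.
exists (ind x), (ind y), (parity k (shift y - shift x)); split=> //.
by apply/signed_edgeP; exists (shift y - shift x) => //; exact: adj_hops.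
Qed.

(** If [s] balanced all edges, [f] would be constant along edges, hence on the connected graph
    [Gamma]; but translation by the basis vector of index [k] changes its parity term and nothing
    else. *)
Lemma signed_edge_unbalanced (u0 : 'I_n) (s : 'I_n -> bool) :
  exists u v b, signed_edge u v b /\ b != s u (+) s v.
Proof.
apply: contrapT => bal.
have balE u v b : signed_edge u v b -> b = s u (+) s v.
  by move=> huv; apply/eqP/negPn/negP => h; apply: bal; exists u, v, b.
pose f x := s (ind x) (+) parity k (shift x).
have fadj x y : adj x y -> f x = f y.
  move=> /adj_hops h; have : signed_edge (ind x) (ind y) (parity k (shift y - shift x)).
    by apply/signed_edgeP; exists (shift y - shift x).
  move/balE; rewrite parityD parityN /f.
  by case: (s _); case: (s _); case: (parity k _); case: (parity k _).
have [p [pp lp]] := connGamma (W u0) (translate (delta_mx 0 k) (W u0)).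
have : f (W u0) = f (last (W u0) p).
  elim: p (W u0) pp {lp} => [|y p IH] x //= /andP[xy pp].
  by rewrite (fadj _ _ xy); exact: IH.
rewrite lp /f indT shiftT shift_rep addr0 parity_delta.
by rewrite /parity mxE absz0; case: (s _).
Qed.

Variable e : {ffun 'I_d -> bool}.
Variables (V : 'I_n -> nat) (w : 'I_n -> 'I_n -> bool -> nat).
Hypothesis w_sym : forall i j b, w i j b = w j i b.
Hypothesis w_supp : forall i j b, ~~ signed_edge i j b -> w i j b = 0%N.

Let multiplicity i j (b : bool) := count (fun a => parity k a == b) (hop_seq W i j).

Lemma multiplicity_sym i j b : multiplicity i j b = multiplicity j i b.
Proof.
rewrite /multiplicity (seq.permP (hop_seq_opp j i)) count_map.
by apply: eq_count => a /=; rewrite parityN.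
Qed.

(* Spreads the weight w i j b evenly over the edges of parity b from W i to the
   orbit of W j, and twists it by the signs e^a so that the Floquet matrix at e
   becomes the untwisted one. *)
Definition twisted_params : parameters R Gamma.
Proof.
refine (@MkParams R d Gamma (fun v => (V (ind v))%:R)
  (fun u v => if adj u v then
     let a := shift v - shift u in
     monomial (@sign_point R d e) a * (w (ind u) (ind v) (parity k a))%:R
       / (multiplicity (ind u) (ind v) (parity k a))%:R else 0) _ _ _ _).
- by move=> a v; rewrite indT.
- by move=> a u v; rewrite adj_translate !indT !shiftT opprD addrACA subrr add0r.
- move=> u v; rewrite adj_sym; case: ifP => // _ /=.
  by rewrite -opprB monomial_sign_pointN parityN w_sym multiplicity_sym.
- by move=> u v /negPf ->.
Defined.

Lemma sum_multiplicity (i j : 'I_n) (c : bool -> R) :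
  \sum_(a <- hop_seq W i j) c (parity k a) * (w i j (parity k a))%:R
     / (multiplicity i j (parity k a))%:R =
  c false * (w i j false)%:R + c true * (w i j true)%:R.
Proof.
have part b : \sum_(a <- hop_seq W i j | parity k a == b)
    c (parity k a) * (w i j (parity k a))%:R / (multiplicity i j (parity k a))%:R =
    c b * (w i j b)%:R.
  rewrite (eq_bigr (fun=> c b * (w i j b)%:R / (multiplicity i j b)%:R)); last first.
    by move=> a /eqP ->.
  rewrite big_const_seq iter_addr_0 -[LHS]mulr_natr.
  (* Without hops of parity [b] the quotient is a division by 0, harmless because the weight
     vanishes too. *)
  have [m0|m0] := eqVneq (multiplicity i j b) 0%N; last first.
    by rewrite mulfVK // pnatr_eq0.
  have -> : w i j b = 0%N.
    by apply: w_supp; rewrite /signed_edge has_count -leqNgt -/(multiplicity i j b) m0.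
  by rewrite mulr0 !mul0r.
rewrite (bigID (fun a => parity k a == false)) /= part; congr (_ + _).
by rewrite -part; apply: eq_bigl => a; case: (parity k a).
Qed.

Lemma twisted_label i j a : hops W i j a ->
  edge_label twisted_params (W i) (translate a (W j)) =
  monomial (@sign_point R d e) a * (w i j (parity k a))%:R
    / (multiplicity i j (parity k a))%:R.
Proof.
by rewrite /hops /= => ->; rewrite indT shiftT !shift_rep !ind_rep subr0 addr0.
Qed.

(** The twist meets the monomial at [e] in a square, which is 1; at [flip k e] the sign of the
    parity remains. *)
Lemma sign_Floquet_twisted b :
  map_mx emb (sign_Floquet (if b then flip k e else e) twisted_params) =
  signed_mx R[i] V w b.
Proof.
apply/matrixP => i j; rewrite [LHS]mxE FloquetE [RHS]mxE rmorphD rmorphMn /=.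
rewrite ind_rep -addrA rmorph_nat; congr (_ + _).
rewrite big_seq (eq_bigr (fun a => (if b then (-1) ^+ parity k a else 1) *
    (w i j (parity k a))%:R / (multiplicity i j (parity k a))%:R)); last first.
  move=> a; rewrite mem_hop_seq inE => ha; have := twisted_label ha.
  rewrite /= ind_rep => ->.
  case: b => /=.
    rewrite monomial_flip; have := monomial_sign_point_sq R e a.
    move: (monomial _ _) => x xx.
    transitivity ((x * x) * ((-1) ^+ parity k a * (w i j (parity k a))%:R
       / (multiplicity i j (parity k a))%:R)); first by ring.
    by rewrite xx mul1r.
  have := monomial_sign_point_sq R e a; move: (monomial _ _) => x xx.
  transitivity ((x * x) * ((w i j (parity k a))%:R
       / (multiplicity i j (parity k a))%:R)); first by ring.
  by rewrite xx !mul1r.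
rewrite -big_seq (sum_multiplicity i j (fun c : bool => if b then (-1) ^+ c else 1)).
rewrite rmorphD !rmorphM /= !rmorph_nat.
by case: b; rewrite ?expr0 ?expr1 ?rmorphN ?rmorph1 ?mul1r.
Qed.
End OneVariable.
End ExistenceOfParameters.

(** * Generic conditions at the points of {+-1}^d *)

Section GenericSignPoints.
Variables (R : realType) (d : nat) (Gamma : periodic_graph d).
Variables (n : nat) (W : 'I_n.+1 -> Gamma).
Hypothesis repW : orbit_representatives W.
Implicit Types (e : {ffun 'I_d -> bool}) (p : parameters R Gamma).

Lemma polynomial_sign_Floquet e :
  polynomial_matrix (sign_Floquet W e : parameters R Gamma -> _).
Proof. exact: polynomial_Floquet. Qed.

Lemma generic_coprime_flip e k : connected_graph Gamma ->
  generic (fun p => \det (horner_mx (sign_Floquet W e p)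
                      (char_poly (sign_Floquet W (flip k e) p))) != 0).
Proof.
move=> connG; apply/genericP.
exists (fun p => \det (horner_mx (sign_Floquet W e p)
                      (char_poly (sign_Floquet W (flip k e) p)))); split=> //.
  (* Here [n.+2] is the size of a characteristic polynomial of degree [n.+1]. *)
  apply: polynomial_det; apply: (@polynomial_horner_mx _ _ _ _ _ _ n.+2).
  - by move=> p; rewrite size_char_poly.
  - exact: polynomial_sign_Floquet.
  - exact/polynomial_char_poly/polynomial_sign_Floquet.
have [ind [shift [coordE indT shiftT repE]]] := exists_coordinates repW.
have ind_rep i : ind (W i) = i by case: (repE i).
have shift_rep i : shift (W i) = 0 by case: (repE i).
have [||V [w [w_sym w_supp disj]]] := @exists_disjoint_signed_spectra R[i] n.+1
    (signed_edge W k) (signed_edge_sym W k) _ _ ord0.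
- exact: (signed_edge_connected connG coordE ind_rep).
- exact: (signed_edge_unbalanced connG coordE indT shiftT shift_rep _ ord0).
(* Witness: the weights with disjoint signed spectra, twisted for [e]. *)
exists (twisted_params R W indT shiftT k e V w_sym).
apply: det_horner_mx_neq0; apply: coprime_char_poly => lambda psi phi psi0 phi0.
have tw b := sign_Floquet_twisted R indT shiftT ind_rep shift_rep e V w_sym w_supp b.
have := tw false; have := tw true; rewrite /= => -> -> hpsi hphi.
exact: disj psi0 phi0 hpsi hphi.
Qed.

Lemma generic_simple_spectrum e :
  generic (fun p => \det (horner_mx (sign_Floquet W e p)
                      (char_poly (sign_Floquet W e p))^`()) != 0).
Proof.
apply/genericP.
exists (fun p => \det (horner_mx (sign_Floquet W e p)
                      (char_poly (sign_Floquet W e p))^`())); split=> //.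
  apply: polynomial_det; apply: (@polynomial_horner_mx _ _ _ _ _ _ n.+2).
  - move=> p; apply: leq_trans (size_poly _ _) _.
    by rewrite size_char_poly.
  - exact: polynomial_sign_Floquet.
  - move=> i; rewrite (_ : (fun p => _) = fun p =>
      (char_poly (sign_Floquet W e p))`_i.+1 * i.+1%:R); last first.
      by apply/funext => p; rewrite coef_deriv mulr_natr.
    apply: polynomial_mul; last exact: polynomial_const.
    exact/polynomial_char_poly/polynomial_sign_Floquet.
have [ind [shift [coordE indT shiftT repE]]] := exists_coordinates repW.
have ind_rep i : ind (W i) = i by case: (repE i).
(* Witness: potential i on the orbit of [W i] and zero edge labels, which gives a diagonal matrix
   with distinct entries. *)
pose V (v : Gamma) : R := (ind v)%:R.
have Vper a v : V (translate a v) = V v by rewrite /V indT.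
exists (@MkParams R d Gamma V (fun _ _ => 0) Vper (fun _ _ _ => erefl)
  (fun _ _ => erefl) (fun _ _ _ => erefl)).
set p := MkParams _ _ _ _.
have entry i j : sign_Floquet W e p i j = (i%:R : R) *+ (i == j).
  rewrite FloquetE /= /V ind_rep big1 ?addr0 // => a _; exact: mul0r.
apply: det_horner_mx_neq0.
rewrite char_poly_trig; last first.
  apply/is_trig_mxP => i j ij; rewrite entry.
  by rewrite (_ : (i == j) = false) //; apply/negbTE; rewrite neq_ltn ij.
rewrite (eq_bigr (fun i : 'I_n.+1 => 'X - (i%:R : R)%:P)); last first.
  by move=> i _; rewrite entry eqxx mulr1n.
rewrite -(big_map (fun i : 'I_n.+1 => i%:R : R) xpredT (fun x => 'X - x%:P)).
set rs := map _ _; have : uniq rs.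
  rewrite map_inj_uniq ?index_enum_uniq // => i j /eqP.
  by rewrite eqr_nat => /eqP ij; apply: val_inj.
by rewrite -separable_prod_XsubC unlock.
Qed.
End GenericSignPoints.

(** * Bands as the real roots of the characteristic polynomial *)

Section BandPolynomial.
Variables (R : realType) (d : nat) (Gamma : periodic_graph d).
Variables (n : nat) (W : 'I_n -> Gamma) (p : parameters R Gamma).
Local Notation emb := (complex_embedding R).
Local Notation Re := (@complex.Re R).
Local Notation point := ('rV[(R[i])^o]_d).
Implicit Types z : point.

Lemma conjc_Floquet z : torus z ->
  map_mx conjc (Floquet W emb (z 0) p) = (Floquet W emb (z 0) p)^T.
Proof.
move=> z1; rewrite Floquet_tr.
apply: (@map_Floquet _ _ _ _ _ _ _ (conjc : {rmorphism R[i] -> R[i]})) => [x|k].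
  exact: conjc_real.
by rewrite (unit_complex_inv (z1 k)).
Qed.

(** The usual argument for a Hermitian matrix: an eigenvector v satisfies x <v, v> = conj(x) <v, v>
    with <v, v> nonzero. *)
Lemma eigenvalue_Floquet_real z x : torus z ->
  root (char_poly (Floquet W emb (z 0) p)) x -> emb (Re x) = x.
Proof.
move=> z1; rewrite -eigenvalue_root_char => /eigenvalueP[v vH v0].
set H := Floquet _ _ _ _ in vH.
pose vc : 'rV[R[i]]_n := map_mx conjc v.
have vcH : vc *m H^T = conjc x *: vc.
  by rewrite -conjc_Floquet // -map_mxM vH map_mxZ.
have e : x *: (v *m vc^T) = conjc x *: (v *m vc^T).
  rewrite scalemxAl -vH -mulmxA -[H]trmxK -trmx_mul vcH.
  by rewrite [in LHS]linearZ -scalemxAr.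
have N0 : (v *m vc^T) 0 0 != 0.
  rewrite mxE; have [i vi] : exists i, v 0 i != 0.
    apply: contrapT => h; case/eqP: v0; apply/rowP => i; rewrite mxE.
    by apply/eqP/negPn/negP => vi; apply: h; exists i.
  have h j : v 0 j * vc^T j 0 = `|v 0 j| ^+ 2 by rewrite !mxE sqr_normc.
  rewrite (eq_bigr _ (fun j _ => h j)) psumr_neq0; last first.
    by move=> j _; rewrite exprn_ge0.
  by apply/hasP; exists i; rewrite ?mem_index_enum //= exprn_gt0 // normr_gt0.
have xx : x = conjc x.
  apply: (mulIf N0); have := congr1 (fun M : 'M[R[i]]_1 => M 0 0) e.
  by rewrite !mxE.
by apply: RRe_real; apply/complex_realP; case: x xx {vH vcH e} => a b [] /eqP;
  rewrite -subr_eq0 opprK -mulr2n mulrn_eq0 /= => /eqP ->; exists a.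
Qed.

Lemma band_poly z : torus z ->
  char_poly (Floquet W emb (z 0) p) =
  map_poly emb (\prod_(j < n) ('X - (band W p j z)%:P)).
Proof.
move=> z1; set H := Floquet _ _ _ _.
have sE : char_poly H = \prod_(x <- eigenvalues H) ('X - x%:P).
  rewrite /eigenvalues; case: closed_field_poly_normal => s /= {1}->.
  by rewrite (monicP (char_poly_monic H)) scale1r.
have size_s : size (eigenvalues H) = n.
  have := size_char_poly H; rewrite sE size_prod_XsubC.
  by move=> [].
set rs := sort <=%O (map Re (eigenvalues H)).
have size_rs : size rs = n by rewrite size_sort size_map.
have -> : \prod_(j < n) ('X - (band W p j z)%:P) = \prod_(x <- rs) ('X - x%:P).
  by rewrite (big_nth 0) big_mkord size_rs.
rewrite rmorph_prod sE /=.
have -> : \prod_(x <- rs) map_poly emb ('X - x%:P)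
   = \prod_(x <- map Re (eigenvalues H)) ('X - (emb x)%:P).
  rewrite (perm_big (map Re (eigenvalues H))) ?perm_sort //=; apply: eq_bigr => x _.
  by rewrite rmorphB /= map_polyX map_polyC.
rewrite big_map big_seq [RHS]big_seq; apply: eq_bigr => x xs.
rewrite (eigenvalue_Floquet_real z1) // -/H sE root_prod_XsubC //.
Qed.

Lemma le_band z (i j : 'I_n) : (i <= j)%N -> band W p i z <= band W p j z.
Proof.
move=> ij; rewrite /band; set rs := map _ _.
have size_rs : size (sort <=%O rs) = n.
  rewrite size_sort size_map /eigenvalues; case: closed_field_poly_normal => s /= sE.
  have := size_char_poly (Floquet W emb (z 0) p).
  by rewrite sE (monicP (char_poly_monic _)) scale1r size_prod_XsubC => -[].
apply: (sorted_leq_nth (@le_trans _ _) (@lexx _ _)) => //.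
- exact: (sort_sorted (@le_total _ _)).
- by rewrite inE size_rs.
- by rewrite inE size_rs.
Qed.

Lemma horner_band_poly z lambda :
  (\prod_(j < n) ('X - (band W p j z)%:P)).[lambda] =
  \prod_(j < n) (lambda - band W p j z).
Proof. by rewrite horner_prod; apply: eq_bigr => j _; rewrite !hornerE. Qed.

Lemma sparse_band_product : minimally_sparse_poly (dispersion_poly W p) ->
  exists (c0 : {poly R}) (c : 'I_d -> {poly R}), forall z lambda, torus z ->
    \prod_(j < n) (lambda - band W p j z) =
    c0.[lambda] + \sum_k (c k).[lambda] * Re (z 0 k).
Proof.
move=> /sparse_dispersion_torus[c0 [c cE]].
(* The sign turns det(H - lambda) into the monic characteristic polynomial. *)
exists ((-1) ^+ n *: c0), (fun k => (-1) ^+ n *: c k) => z lambda z1.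
apply: (@complexI R); rewrite -horner_band_poly -[LHS]horner_map -band_poly //.
rewrite /char_poly -[LHS]/(horner_eval _ _) -det_map_mx.
have -> : map_mx (horner_eval (emb lambda)) (char_poly_mx (Floquet W emb (z 0) p))
   = (-1) *: (Floquet W emb (z 0) p - (emb lambda)%:M).
  apply/matrixP => i j; rewrite !mxE /= /horner_eval hornerD hornerN hornerMn.
  by rewrite hornerC hornerX mulN1r opprB.
rewrite detZ cE // -[in LHS](rmorphN1 emb) -rmorphXn -rmorphM /=; congr (_ %:C)%C.
rewrite mulrDr mulr_sumr hornerZ; congr (_ + _); apply: eq_bigr => k _.
by rewrite hornerZ mulrA.
Qed.

Definition real_point (e : {ffun 'I_d -> bool}) : point :=
  \row_k emb (sign_point R e k).

Lemma torus_real_point e : torus (real_point e).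
Proof.
move=> k; rewrite mxE /sign_point; case: (e k); rewrite ?expr0 ?expr1.
  by rewrite rmorphN1 normrN1.
by rewrite rmorph1 normr1.
Qed.

Lemma char_poly_sign_Floquet e :
  char_poly (sign_Floquet W e p) = \prod_(j < n) ('X - (band W p j (real_point e))%:P).
Proof.
apply: (@map_poly_inj _ _ emb); rewrite -band_poly; last exact: torus_real_point.
rewrite map_char_poly; congr char_poly.
by apply: map_Floquet => // k; rewrite mxE.
Qed.
End BandPolynomial.

Section GoodSignPoints.
Variables (R : realType) (d : nat) (Gamma : periodic_graph d).
Variables (n : nat) (W : 'I_n.+1 -> Gamma) (p : parameters R Gamma).
Variable e : {ffun 'I_d -> bool}.

(** A repeated band value is a double root, common to the characteristic polynomial and its
    derivative. *)
Lemma simple_spectrum_bands :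
  \det (horner_mx (sign_Floquet W e p) (char_poly (sign_Floquet W e p))^`()) != 0 ->
  injective (fun j => band W p j (real_point R e)).
Proof.
move=> det0 i j /= bij; apply/eqP/negPn/negP => ij; case/eqP: det0.
apply: (@det_horner_mx_common_root _ _ _ _ (band W p i (real_point R e)));
  rewrite char_poly_sign_Floquet.
  by rewrite (bigD1 i) //= rootM root_XsubC eqxx.
rewrite (bigD1 i) //= (bigD1 j) 1?eq_sym //= mulrA -bij.
set q := (X in _ * _ * X); rewrite /root derivM derivM derivXsubC mul1r mulr1.
by rewrite hornerD !hornerM hornerD hornerXsubC subrr !(mul0r, addr0).
Qed.

Lemma coprime_flip_bands k :
  \det (horner_mx (sign_Floquet W e p) (char_poly (sign_Floquet W (flip k e) p))) != 0 ->
  forall lambda, \prod_j (lambda - band W p j (real_point R e)) = 0 ->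
    \prod_j (lambda - band W p j (real_point R (flip k e))) = 0 -> False.
Proof.
move=> det0 lambda h1 h2; case/eqP: det0.
apply: (@det_horner_mx_common_root _ _ _ _ lambda); rewrite char_poly_sign_Floquet.
  by rewrite /root horner_band_poly h1.
by rewrite /root horner_band_poly h2.
Qed.
End GoodSignPoints.

(** * Continuity and extrema of the bands *)

Section SortedRoots.
Variable R : realType.

Lemma continuous_bigprod (T : topologicalType) (x : T) (I : Type) (r : seq I)
    (P : pred I) (f : I -> T -> R) : (forall i, {for x, continuous (f i)}) ->
  {for x, continuous (fun t => \prod_(i <- r | P i) f i t)}.
Proof.
by move=> cf; apply: (cvg_big (@mul_continuous R)) => i _; exact: cf.
Qed.

Lemma continuous_bigsum (T : topologicalType) (x : T) (I : Type) (r : seq I)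
    (P : pred I) (f : I -> T -> R) : (forall i, {for x, continuous (f i)}) ->
  {for x, continuous (fun t => \sum_(i <- r | P i) f i t)}.
Proof.
by move=> cf; apply: (cvg_big (@add_continuous R)) => i _; exact: cf.
Qed.

Lemma eq_sorted_roots n (v w : 'I_n -> R) :
  (forall i j : 'I_n, (i <= j)%N -> v i <= v j) ->
  (forall i j : 'I_n, (i <= j)%N -> w i <= w j) ->
  (forall lambda, \prod_i (lambda - v i) = \prod_i (lambda - w i)) -> v =1 w.
Proof.
move=> sv sw vw.
have /prod_XsubC_eq vw_perm :
    \prod_(x <- map v (enum 'I_n)) ('X - x%:P) =
    \prod_(x <- map w (enum 'I_n)) ('X - x%:P).
  rewrite 2!big_map !big_enum; apply: poly_ext => lambda.
  rewrite !horner_prod (eq_bigr (fun i => lambda - v i)) => [|i _];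
    last by rewrite !hornerE.
  rewrite vw; apply: eq_bigr => i _; by rewrite !hornerE.
have sorted_map (u : 'I_n -> R) : (forall i j : 'I_n, (i <= j)%N -> u i <= u j) ->
    sorted <=%O (map u (enum 'I_n)).
  move=> su; rewrite sorted_map; apply: (@sub_sorted _ (relpre val leq)).
    by move=> i j; exact: su.
  by rewrite -sorted_map val_enum_ord; exact: iota_sorted.
have := le_sorted_eq (sorted_map v sv) (sorted_map w sw) vw_perm.
by move=> /eq_in_map e i; apply: e; rewrite mem_enum.
Qed.

(* By compactness of a box, it suffices that each v in it other than the root
   vector at t0 has a neighbourhood avoiding the root vectors for t near t0: either
   v is unsorted, or its product differs from that of t0 at some lambda. *)
Lemma continuous_sorted_roots n (T : topologicalType) (g : 'I_n -> T -> R)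
    (M : R) (t0 : T) :
  (forall (i j : 'I_n) t, (i <= j)%N -> g i t <= g j t) ->
  (forall i t, `|g i t| <= M) ->
  (forall lambda, {for t0, continuous (fun t => \prod_i (lambda - g i t))}) ->
  forall i, {for t0, continuous (g i)}.
Proof.
move=> sg gM gC i; apply/cvgrPdist_lt => eps eps0.
pose box : set 'rV[R]_n := [set v | forall j, (`[- M, M]%classic : set R) (v ord0 j)].
have cbox : compact box.
  apply: (@rV_compact R n (fun=> `[- M, M]%classic)) => j.
  exact: segment_compact.
have near_box : \forall t \near t0,
    box `<=` [set v | v = \row_j g j t -> `|g i t0 - v 0 i| < eps].
  move/compact_near_coveringP: cbox; apply => v boxv.
  have coordv (j : 'I_n) : {for v, continuous (fun u : 'rV[R]_n => u 0 j)}.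
    exact: coord_continuous.
  have [vt0|vt0] := pselect (v = \row_j g j t0).
    have /cvgrPdist_lt/(_ _ eps0) near_v := coordv i.
    exists ([set u : 'rV[R]_n | `|v 0 i - u 0 i| < eps], setT).
      by split; [exact: near_v|exact: filterT].
    by move=> [u t] /= [h _] _; rewrite [v]vt0 mxE in h.
  have [sv|/existsNP[a /existsNP[b /not_implyP[ab /negP]]]] :=
      pselect (forall a b : 'I_n, (a <= b)%N -> v 0 a <= v 0 b).
    have : ~ (forall lambda, \prod_j (lambda - v 0 j) = \prod_j (lambda - g j t0)).
      move=> h; apply: vt0; apply/rowP => j; rewrite mxE.
      by apply: (@eq_sorted_roots n (v 0) (fun j => g j t0)) => // a b; exact: sg.
    move=> /existsNP[lambda /eqP ne].
    set x := \prod_j (lambda - v 0 j) in ne.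
    set y := \prod_j (lambda - g j t0) in ne.
    have del0 : 0 < `|x - y| / 2 by rewrite divr_gt0 // normr_gt0 subr_eq0.
    have cv : {for v, continuous (fun u : 'rV[R]_n => \prod_j (lambda - u 0 j))}.
      apply: continuous_bigprod => j.
      by apply: continuousB; [exact: cst_continuous|exact: coordv].
    have /cvgrPdist_lt/(_ _ del0) near_v := cv.
    have /cvgrPdist_lt/(_ _ del0) near_t := gC lambda.
    exists ([set u : 'rV[R]_n | `|x - \prod_j (lambda - u 0 j)| < `|x - y| / 2],
            [set t | `|y - \prod_j (lambda - g j t)| < `|x - y| / 2]); first by [].
    move=> [u t] /= [hu ht] ut; exfalso.
    move: hu; rewrite ut (eq_bigr (fun j => lambda - g j t)) => [hu|j _]; last first.
      by rewrite mxE.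
    rewrite distrC in ht.
    have := ler_distD (\prod_j (lambda - g j t)) x y.
    by move: hu ht; set dx := `|x - _|; set dy := `|_ - y|; set dd := `|x - y|; lra.
  rewrite -ltNge => ba.
  have del0 : 0 < (v 0 a - v 0 b) / 2 by rewrite divr_gt0 // subr_gt0.
  have /cvgrPdist_lt/(_ _ del0) near_a := coordv a.
  have /cvgrPdist_lt/(_ _ del0) near_b := coordv b.
  exists ([set u : 'rV[R]_n | `|v 0 a - u 0 a| < (v 0 a - v 0 b) / 2 /\
     `|v 0 b - u 0 b| < (v 0 a - v 0 b) / 2], setT).
    by split; [exact: filterI near_a near_b|exact: filterT].
  move=> [u t] /= [[ha hb] _] ut; exfalso.
  have := sg a b t ab; rewrite leNgt => /negP; apply.
  move: ha hb; rewrite ut !mxE !ltr_norml => /andP[h1 h2] /andP[h3 h4].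
  by lra.
apply: filterS near_box => t /(_ (\row_j g j t)) h.
have := h _ erefl; rewrite mxE; apply => j /=.
by rewrite mxE in_itv /= -ler_norml.
Qed.
End SortedRoots.

(** * Differentials of products and of functions of one coordinate *)

Section Differentials.
Variables (R : realType) (V : normedModType R).
Implicit Types (f g h q : V -> R) (x : V).

Lemma eps_differentiable f x (df : {linear V -> R}) : continuous df ->
  (forall eps : R, 0 < eps ->
     \forall v \near (0 : V), `|f (v + x) - f x - df v| <= eps * `|v|) ->
  differentiable f x /\ 'd f x = df :> (V -> R).
Proof.
move=> cdf hf.
have E : f \o shift x = cst (f x) + df +o_ (0 : V) id.
  apply/eqaddoP => eps eps0; apply: filterS (hf _ eps0) => v /=.
  by rewrite /cst /= opprD addrA.
have dfE := diff_unique cdf E.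
split=> //; apply/diff_locallyP; rewrite dfE; split=> //.
Qed.

Lemma differentiable_eps f x : differentiable f x ->
  forall eps : R, 0 < eps ->
    \forall v \near (0 : V), `|f (v + x) - f x - 'd f x v| <= eps * `|v|.
Proof.
move=> /diff_locally/eqaddoP h eps eps0; apply: filterS (h _ eps0) => v /=.
by rewrite /cst /= opprD addrA.
Qed.

Lemma near_eq_differentiable f g x : (\forall y \near x, f y = g y) ->
  differentiable g x -> differentiable f x /\ 'd f x = 'd g x :> (V -> R).
Proof.
move=> fg dg; apply: eps_differentiable; first exact: diff_continuous.
move=> eps eps0.
have nfg : \forall v \near (0 : V), f (v + x) = g (v + x).
  by move: fg; rewrite (near_shift 0) subr0.
apply: filterS2 nfg (differentiable_eps dg eps0) => v ->.
by rewrite (nbhs_singleton fg).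
Qed.

(* The factor q need not be differentiable, because h vanishes at x. *)
Lemma differentiable_mul_vanishing h q x : differentiable h x -> h x = 0 ->
  {for x, continuous q} ->
  differentiable (fun y => h y * q y) x /\
  forall v, 'd (fun y => h y * q y) x v = q x * 'd h x v.
Proof.
move=> dh hx cq.
have cdh : continuous ('d h x) := diff_continuous dh.
have [k k0 lip] := linear_lipschitz cdh.
have cqdh : continuous (q x \*: 'd h x).
  by move=> v; apply: cvgZr; exact: cdh.
have [|dhq ->] :=
    @eps_differentiable (fun y => h y * q y) x (q x \*: 'd h x) cqdh; last first.
- by split.
move=> eps eps0; rewrite hx mul0r.
(* The error is split as (h - dh) q + dh (q - q(x)). The first term uses [e1] and the bound |q| <=
   |q(x)| + 1 near x, the second [e2] and a Lipschitz constant [k] of dh; each takes half of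
   [eps]. *)
pose e1 := eps / (2 * (`|q x| + 1)).
have q10 : 0 < `|q x| + 1 by rewrite ltr_wpDl.
have e10 : 0 < e1 by rewrite divr_gt0 // mulr_gt0.
pose e2 := eps / (2 * k).
have e20 : 0 < e2 by rewrite divr_gt0 // mulr_gt0.
have near_h := differentiable_eps dh e10.
have near_q : \forall v \near (0 : V), `|q x - q (v + x)| < Num.min 1 e2.
  have m0 : 0 < Num.min 1 e2 by rewrite lt_min ltr01.
  have : \forall t \near x, `|q x - q t| < Num.min 1 e2.
    by move/cvgrPdist_lt: cq => /(_ _ m0).
  by rewrite (near_shift (0 : V)) subr0.
apply: filterS2 near_h near_q => v.
rewrite hx subr0 lt_min => hv /andP[q1 q2].
have lipv := lip v.
have -> : h (v + x) * q (v + x) - 0 - q x * 'd h x v =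
    (h (v + x) - 'd h x v) * q (v + x) + 'd h x v * (q (v + x) - q x) by ring.
apply: le_trans (ler_normD _ _) _; rewrite !normrM.
have qb : `|q (v + x)| <= `|q x| + 1.
  rewrite -[q (v + x)](subrK (q x)) addrC (le_trans (ler_normD _ _)) // lerD2l.
  by rewrite distrC ltW.
have -> : eps * `|v| = e1 * `|v| * (`|q x| + 1) + k * `|v| * e2.
  by rewrite /e1 /e2; field; rewrite !gt_eqF.
apply: lerD; apply: ler_pM => //.
by rewrite distrC ltW.
Qed.
End Differentials.

Section CoordinateFunctions.
Variables (R : realType) (d : nat).
Implicit Types (t : 'rV[R]_d) (k : 'I_d).

Lemma differentiable_comp_coord (u du : R -> R) k t :
  (forall s, is_derive s (1 : R) u (du s)) ->
  differentiable (fun t' : 'rV[R]_d => u (t' 0 k)) t /\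
  forall v, 'd (fun t' : 'rV[R]_d => u (t' 0 k)) t v = du (t 0 k) * v 0 k.
Proof.
move=> hu.
have dc : differentiable (fun t' : 'rV[R]_d => t' 0 k) t by exact: differentiable_coord.
have du1 : differentiable u (t 0 k) by apply/derivable1_diffP; case: (hu (t 0 k)).
split; first exact: (differentiable_comp dc du1).
move=> v; rewrite (_ : (fun t' => _) = u \o (fun t' : 'rV[R]_d => t' 0 k)) //.
rewrite diff_comp //= (_ : 'd (fun t' : 'rV[R]_d => t' 0 k) t v = v 0 k).
  rewrite diff1E //= derive1E (_ : 'D_1 u (t 0 k) = du (t 0 k)).
    by rewrite mulrC.
  by case: (hu (t 0 k)).
have @f : {linear 'rV[R]_d -> R}.
  by exists (fun N : 'rV[R]_d => N 0 k); do 2![eexists]; do ?[constructor];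
     rewrite ?mxE// => ? *; rewrite ?mxE//; move=> ?; rewrite !mxE.
by rewrite (_ : (fun _ => _) = f) // diff_lin //; exact: coord_continuous.
Qed.
End CoordinateFunctions.

(** * The angular chart of the torus *)

Section Chart.
Variables (R : realType) (d : nat).
Local Notation Re := (@complex.Re R).
Local Notation Im := (@complex.Im R).
Local Notation point := ('rV[(R[i])^o]_d).
Implicit Types (x : point) (t : 'rV[R]_d).

Lemma norm_cis (s : R) : `|(cos s +i* sin s)%C| = 1.
Proof. by rewrite normc_def /= cos2Dsin2 sqrtr1. Qed.

Lemma torus_torus_chart x t : torus x -> torus (torus_chart x t).
Proof.
move=> x1 k; rewrite mxE.
by rewrite -[RHS](mulr1 1) -{1}(x1 k) -(norm_cis (t 0 k)) -normrM.
Qed.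

Lemma torus_chart0 x : torus_chart x 0 = x.
Proof. by apply/rowP => k; rewrite !mxE cos0 sin0 mulr1. Qed.

Lemma Re_torus_chart x t k :
  Re (torus_chart x t 0 k) = Re (x 0 k) * cos (t 0 k) - Im (x 0 k) * sin (t 0 k).
Proof. by rewrite mxE; case: (x 0 k). Qed.

Lemma normc_le (a b : R) : `|(a +i* b)%C| <= (`|a| + `|b|)%:C%C.
Proof.
rewrite normc_def lecR /= -(@ler_pXn2r _ 2) ?nnegrE ?sqrtr_ge0 ?addr_ge0 //.
rewrite sqr_sqrtr ?addr_ge0 ?sqr_ge0 // sqrrD !real_normK ?num_real //.
by rewrite -addrA [X in _ <= _ + X]addrC addrA lerDl mulrn_wge0 // mulr_ge0.
Qed.

(** Multiplication by the unimodular x_k is an isometry, so in coordinate k the point of the chart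
    is at distance |1 - e^(i t_k)| <= |1 - cos t_k| + |sin t_k| from x. *)
Lemma near_torus_chart x (P : point -> Prop) : torus x ->
  (\forall y \near within (@torus R d) (nbhs x), P y) ->
  \forall t \near (0 : 'rV[R]_d), P (torus_chart x t).
Proof.
move=> x1 /nbhs_ballP[e /= e0 ballP].
(* The radius is a positive element of [R[i]], hence real. *)
have [r er] : exists r : R, e = r%:C%C.
  by apply/complex_realP; rewrite gtr0_real.
have r0 : 0 < r by rewrite er ltcR in e0.
have r20 : 0 < r / 2 by rewrite divr_gt0.
have near_k (k : 'I_d) : \forall t \near (0 : 'rV[R]_d),
    `|1 - cos ((t : 'rV[R]_d) 0 k)| < r / 2 /\ `|sin ((t : 'rV[R]_d) 0 k)| < r / 2.
  have ck (u : R -> R) : continuous u ->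
      {for (0 : 'rV[R]_d), continuous (fun t : 'rV[R]_d => u (t 0 k))}.
    move=> cu; apply: (@continuous_comp _ _ _ (fun t : 'rV[R]_d => t 0 k) u).
      exact: coord_continuous.
    exact: cu.
  have /cvgrPdist_lt/(_ _ r20) := ck cos (@continuous_cos R).
  have /cvgrPdist_lt/(_ _ r20) := ck sin (@continuous_sin R).
  rewrite !mxE sin0 cos0 => hs hc; apply: filterS2 hs hc => t; rewrite sub0r normrN.
  by [].
have near_all : \forall t \near (0 : 'rV[R]_d), forall k : 'I_d,
    `|1 - cos ((t : 'rV[R]_d) 0 k)| < r / 2 /\ `|sin ((t : 'rV[R]_d) 0 k)| < r / 2.
  exact: (@filter_forall _ _ _ _ (nbhs_filter _) near_k).
apply: filterS near_all => t ht; apply: ballP; last exact: torus_torus_chart.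
split=> [|i k]; first exact: e0.
rewrite (ord1 i) /ball /= mxE er.
rewrite -{1}[x 0 k]mulr1 -mulrBr normrM x1 mul1r.
rewrite (_ : 1 - _ = ((1 - cos (t 0 k)) +i* (- sin (t 0 k)))%C); last first.
  by apply/eqP; rewrite eq_complex /= sub0r !eqxx.
apply: le_lt_trans (normc_le _ _) _; rewrite ltcR normrN.
by have [h1 h2] := ht k; rewrite [r](splitr r) ltrD.
Qed.
End Chart.

Lemma prod_sub_root (A : comPzRingType) (I : finType) (f : I -> A) j :
  \prod_i (f j - f i) = 0.
Proof. by rewrite (bigD1 j) //= subrr mul0r. Qed.

(** * Injectivity and extrema in one real variable *)

Section LineLemmas.
Variable R : realType.

Lemma near0_ball (P : R -> Prop) : (\forall s \near (0 : R), P s) ->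
  exists2 delta : R, 0 < delta & forall s, `|s| < delta -> P s.
Proof.
move=> /nbhs_ballP[delta /= delta0 h]; exists delta => // s sd; apply: h.
by rewrite /ball /= sub0r normrN.
Qed.

(** The derivative at 0 is - b, so it has no zero near 0, and Rolle's theorem excludes equal
    values. *)
Lemma trig_injective_near0 (a b : R) : b != 0 ->
  exists2 delta : R, 0 < delta & forall s1 s2, `|s1| < delta -> `|s2| < delta ->
    a * cos s1 - b * sin s1 = a * cos s2 - b * sin s2 -> s1 = s2.
Proof.
move=> b0; pose u s := a * cos s - b * sin s.
pose du s := - (a * sin s) - b * cos s.
have u_der s : is_derive s (1 : R) u (du s).
  have -> : u = a *: cos - b *: sin by apply/funext.
  by apply: is_derive_eq; rewrite /du /GRing.scale /= mulrN.
have du_cont : continuous du.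
  move=> s; apply: (@continuousB _ _ _ (fun s => - (a * sin s)) (fun s => b * cos s)).
    apply: (@continuousN _ _ _ (fun s => a * sin s)).
    by apply: continuousM; [exact: cst_continuous|exact: continuous_sin].
  by apply: continuousM; [exact: cst_continuous|exact: continuous_cos].
have : \forall s \near (0 : R), du s != 0.
  have du0 : du 0 != 0 by rewrite /du sin0 cos0 mulr0 oppr0 sub0r mulr1 oppr_eq0.
  exact: (cvgr_neq0 _ (du_cont 0) du0).
move=> /nbhs_ballP[delta /= delta0 hdelta]; exists delta => //.
have rolle s1 s2 : `|s1| < delta -> `|s2| < delta -> u s1 = u s2 -> s1 < s2 -> False.
  move=> d1 d2 u12 s12.
  have [||x] := @Rolle R u s1 s2 s12 _ _ u12.
  - by move=> x _; case: (u_der x).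
  - apply: derivable_within_continuous => x _; by case: (u_der x).
  move=> /andP[/= x1 x2] [_ dx]; have := hdelta x.
  rewrite /ball /= sub0r normrN => h; move: d1 d2 x1 x2.
  rewrite !ltr_norml !bnd_simp => /andP[l1 _] /andP[_ l2] x1 x2.
  have /h : `|x| < delta by rewrite ltr_norml (lt_trans l1 x1) (lt_trans x2 l2).
  by case: (u_der x) => _ <-; rewrite dx eqxx.
move=> s1 s2 d1 d2 u12; case: (ltrgtP s1 s2) => // s12.
  by case: (rolle s1 s2).
by case: (rolle s2 s1).
Qed.

(** A continuous injective function on an interval is strictly monotone, hence takes values on both
    sides of [phi 0]. *)
Lemma injective_no_extremum (phi : R -> R) (delta : R) :
  continuous phi -> 0 < delta ->
  (forall s1 s2, `|s1| < delta -> `|s2| < delta -> phi s1 = phi s2 -> s1 = s2) ->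
  (forall s, `|s| < delta -> phi s <= phi 0) \/
  (forall s, `|s| < delta -> phi 0 <= phi s) -> False.
Proof.
move=> cphi delta0 inj ext.
have in_I s : (s \in `](- delta), delta[) = (`|s| < delta).
  by rewrite in_itv /= ltr_norml.
have inj_I : {in `](- delta), delta[ &, injective phi}.
  by move=> s1 s2; rewrite !in_I; exact: inj.
have cont_I : {within [set` `](- delta), delta[], continuous phi}.
  exact: continuous_subspaceT.
have mono := itv_continuous_inj_mono cont_I inj_I.
have h2 : `|delta / 2| < delta by rewrite ger0_norm ?divr_ge0 ?ltW //; lra.
have h2' : `|- (delta / 2)| < delta by rewrite normrN.
have h0 : `|0 : R| < delta by rewrite normr0.
have p2 : 0 < delta / 2 by rewrite divr_gt0.
have n2 : - (delta / 2) < 0 by rewrite oppr_lt0.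
case: mono => mono.
- have up : phi 0 < phi (delta / 2) by apply: mono; rewrite ?in_I.
  have dn : phi (- (delta / 2)) < phi 0 by apply: mono; rewrite ?in_I.
  by case: ext => h; [have := h _ h2|have := h _ h2']; rewrite leNgt ?up ?dn.
- have up : phi (delta / 2) < phi 0 by apply: mono; rewrite ?in_I.
  have dn : phi 0 < phi (- (delta / 2)) by apply: mono; rewrite ?in_I.
  by case: ext => h; [have := h _ h2'|have := h _ h2]; rewrite leNgt ?up ?dn.
Qed.
End LineLemmas.

(** * Continuity of the bands and reality of their extrema *)

Section Extrema.
Variables (R : realType) (d : nat) (Gamma : periodic_graph d).
Variables (n : nat) (W : 'I_n -> Gamma) (p : parameters R Gamma).
Local Notation emb := (complex_embedding R).
Local Notation Re := (@complex.Re R).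
Local Notation Im := (@complex.Im R).
Local Notation point := ('rV[(R[i])^o]_d).
Local Notation band := (band W p).
Variables (c0 : {poly R}) (c : 'I_d -> {poly R}).
Hypothesis band_product : forall (z : point) lambda, torus z ->
  \prod_(j < n) (lambda - band j z) =
  c0.[lambda] + \sum_k (c k).[lambda] * Re (z 0 k).
Implicit Types (x z : point) (t : 'rV[R]_d).

Lemma Re_torus_le1 z k : torus z -> `|Re (z 0 k)| <= 1.
Proof.
by move=> z1; rewrite -lecR; apply: le_trans (normc_ge_Re _) _; rewrite z1.
Qed.

(** The bands are the roots of a monic polynomial whose coefficients are bounded on the torus,
    because |Re z_k| <= 1; the Cauchy bound on roots applies. *)
Lemma bands_bounded : exists M, forall z j, torus z -> `|band j z| <= M.
Proof.
exists (1 + \sum_(i < n.+1) (`|c0`_i| + \sum_k `|(c k)`_i|)) => z j z1.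
pose q := \prod_(i < n) ('X - (band i z)%:P).
have qE : q = c0 + \sum_k Re (z 0 k) *: c k.
  apply: poly_ext => lambda; rewrite horner_band_poly band_product // hornerD.
  congr (_ + _); rewrite horner_sum; apply: eq_bigr => k _.
  by rewrite hornerZ mulrC.
have q_monic : q \is monic by rewrite monic_prod_XsubC.
have size_q : size q = n.+1 by rewrite /q -big_enum size_prod_XsubC size_enum_ord.
have q_root : q.[band j z] = 0.
  by rewrite horner_band_poly (bigD1 j) //= subrr mul0r.
have := cauchy_boundP (monic_neq0 q_monic) q_root.
move/ltW/le_trans; apply; rewrite /cauchy_bound (monicP q_monic) normr1 invr1 mul1r.
rewrite lerD2l size_q; apply: ler_sum => i _; rewrite qE coefD coef_sum.
apply: le_trans (ler_normD _ _) _; rewrite lerD2l.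
apply: le_trans (ler_norm_sum _ _ _) _; apply: ler_sum => k _.
by rewrite coefZ normrM ler_piMl // Re_torus_le1.
Qed.

Lemma continuous_band_chart x j t0 : torus x ->
  {for t0, continuous (fun t => band j (torus_chart x t))}.
Proof.
move=> x1; have [M hM] := bands_bounded.
apply: (@continuous_sorted_roots R n _ (fun i t => band i (torus_chart x t)) M).
- by move=> a b t; exact: le_band.
- by move=> a t; apply: hM; exact: torus_torus_chart.
move=> lambda.
rewrite (_ : (fun t => _) = fun t => c0.[lambda] + \sum_k (c k).[lambda] *
    (Re (x 0 k) * cos (t 0 k) - Im (x 0 k) * sin (t 0 k))); last first.
  apply/funext => t; rewrite band_product; last exact: torus_torus_chart.
  by congr (_ + _); apply: eq_bigr => k _; rewrite Re_torus_chart.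
apply: continuousD; first exact: cst_continuous.
apply: continuous_bigsum => k.
have ck (u : R -> R) : continuous u ->
    {for t0, continuous (fun t : 'rV[R]_d => u (t 0 k))}.
  move=> cu; apply: (@continuous_comp _ _ _ (fun t : 'rV[R]_d => t 0 k) u).
    exact: coord_continuous.
  exact: cu.
apply: continuousM; first exact: cst_continuous.
apply: continuousB; apply: continuousM; try exact: cst_continuous.
  exact: (ck cos (@continuous_cos R)).
exact: (ck sin (@continuous_sin R)).
Qed.

Lemma extremum_critical x j k : torus x -> local_extremum W p j x ->
  (c k).[band j x] != 0 -> Im (x 0 k) = 0.
Proof.
move=> x1 ext ck0; apply/eqP/negPn/negP => Im0.
pose line (s : R) : 'rV[R]_d := s *: delta_mx 0 k.
have lineE s l : line s 0 l = s * (l == k)%:R by rewrite !mxE eqxx.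
have cline : continuous line by exact: scalel_continuous.
pose phi s := band j (torus_chart x (line s)).
have line0 : line 0 = 0 by rewrite /line scale0r.
have phi0 : phi 0 = band j x by rewrite /phi line0 torus_chart0.
have cphi : continuous phi.
  move=> s; apply: (@continuous_comp _ _ _ line
    (fun t => band j (torus_chart x t))); first exact: cline.
  exact: continuous_band_chart.
(* Along the line only coordinate [k] moves, and [A] collects the part of the dispersion polynomial
   whose coefficients do not depend on s. *)
pose A := c0 + \sum_(l | l != k) Re (x 0 l) *: c l.
have phiE s : A.[phi s] +
    (c k).[phi s] * (Re (x 0 k) * cos s - Im (x 0 k) * sin s) = 0.
  have zero : \prod_(i < n) (phi s - band i (torus_chart x (line s))) = 0.
    exact: (prod_sub_root (fun i => band i (torus_chart x (line s))) j).
  rewrite -[RHS]zero band_product; last exact: torus_torus_chart.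
  move: (phi s) => mu.
  rewrite [in RHS](bigD1 k isT).
  rewrite Re_torus_chart lineE eqxx.
  rewrite mulr1.
  rewrite hornerD.
  rewrite horner_sum.
  rewrite -!addrA; congr (_ + _); rewrite addrC; congr (_ + _).
  apply: eq_bigr => l lk; rewrite Re_torus_chart lineE (negPf lk) mulr0 cos0 sin0.
  by rewrite mulr1 mulr0 subr0 hornerZ mulrC.
have [d1 d10 inj] := trig_injective_near0 (Re (x 0 k)) Im0.
have : \forall s \near (0 : R), (c k).[phi s] != 0 .
  have cc : continuous (fun s => (c k).[phi s]).
    move=> s; apply: (@continuous_comp _ _ _ phi (horner (c k))); first exact: cphi.
    exact: continuous_horner.
  have cphi0 : (c k).[phi 0] != 0 by rewrite phi0.
  exact: (cvgr_neq0 _ (cc 0) cphi0).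
move=> /near0_ball[d2 d20 ck].
have near_line (P : 'rV[R]_d -> Prop) : (\forall t \near (0 : 'rV[R]_d), P t) ->
    \forall s \near (0 : R), P (line s).
  by rewrite -line0 => h; exact: (cline 0 P h).
have [d3 d30 ext3] : exists2 d3 : R, 0 < d3 &
    (forall s, `|s| < d3 -> phi s <= phi 0) \/
    (forall s, `|s| < d3 -> phi 0 <= phi s).
  case: ext => ext; have [d3 d30 h] := near0_ball (near_line _ (near_torus_chart x1 ext)).
    by exists d3; [exact: d30|left=> s ds; rewrite phi0; exact: (h s ds)].
  by exists d3; [exact: d30|right=> s ds; rewrite phi0; exact: (h s ds)].
pose delta := Num.min d1 (Num.min d2 d3).
have delta0 : 0 < delta by rewrite !lt_min d10 d20.
clearbody phi.
apply: (injective_no_extremum cphi delta0).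
  (* Equal band values give the same value of [A] and the same nonzero value of c_k, so the two
     trigonometric factors agree. *)
  move=> s1 s2; rewrite !lt_min => /and3P[a1 a2 _] /and3P[b1 b2 _] e12.
  apply: inj => //; have h1 := phiE s1; have h2 := phiE s2; rewrite e12 in h1.
  by apply: (mulfI (ck s2 b2)); apply: (addrI A.[phi s2]); rewrite h1 h2.
by case: ext3 => h; [left|right] => s; rewrite !lt_min => /and3P[_ _ d3s]; exact: h.
Qed.
End Extrema.

Lemma diff_bigsum (R : realType) (V : normedModType R) (x : V) (I : Type)
    (r : seq I) (f df : I -> V -> R) :
  (forall i, differentiable (f i) x /\ forall v, 'd (f i) x v = df i v) ->
  differentiable (fun t => \sum_(i <- r) f i t) x /\
  forall v, 'd (fun t => \sum_(i <- r) f i t) x v = \sum_(i <- r) df i v.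
Proof.
move=> hf; elim: r => [|i r [IH1 IH2]].
  rewrite (_ : (fun t => _) = cst 0); last by apply/funext => t; rewrite big_nil.
  split; first exact: differentiable_cst.
  by move=> v; rewrite diff_cst big_nil.
have [d1 d2] := hf i.
rewrite (_ : (fun t => _) = f i + (fun t => \sum_(i <- r) f i t)); last first.
  by apply/funext => t; rewrite big_cons.
split; first exact: differentiableD.
by move=> v; rewrite diffD // big_cons -d2 -IH2.
Qed.

(** Removing from each factor the finitely many other coordinates of points of [A] leaves an open
    box that meets [A] only at [x]. *)
Lemma isolated_finite (T U : topologicalType) (A : set (T * U)) x :
  hausdorff_space T -> hausdorff_space U -> finite_set A -> A x -> isolated A x.
Proof.
move=> /hausdorff_accessible/accessible_finite_set_closed clT.
move=> /hausdorff_accessible/accessible_finite_set_closed clU finA Ax.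
split; first exact: mem_set.
pose A1 := fst @` A `\ x.1; pose A2 := snd @` A `\ x.2.
have fin1 : finite_set A1 by apply: finite_setD; exact: finite_image.
have fin2 : finite_set A2 by apply: finite_setD; exact: finite_image.
exists ((~` A1) `*` (~` A2)).
  exists (~` A1, ~` A2) => //; split; apply: open_nbhs_nbhs; split.
  - exact: closed_openC (clT _ fin1).
  - by move=> [_ /(_ erefl)].
  - exact: closed_openC (clU _ fin2).
  - by move=> [_ /(_ erefl)].
apply/seteqP; split=> [y [[y1 y2] Ay]|y ->]; last first.
  by split=> //; split; move=> [_ /(_ erefl)].
rewrite [x]surjective_pairing [y]surjective_pairing /=; congr (_, _).
  by apply: contrapT => ne; apply: y1; split; [exists y|].
by apply: contrapT => ne; apply: y2; split; [exists y|].
Qed.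

(** * First and second derivatives of a simple band *)

Section Branch.
Variables (R : realType) (d n : nat) (c0 : {poly R}) (c : 'I_d -> {poly R}).
Variables (sg : 'I_d -> R) (gam : 'I_n -> 'rV[R]_d -> R) (j : 'I_n).
Hypothesis cgam : forall i, continuous (gam i).
Hypothesis prodE : forall t lambda, \prod_i (lambda - gam i t) =
  c0.[lambda] + \sum_k (c k).[lambda] * (sg k * cos (t 0 k)).
Implicit Types (t : 'rV[R]_d).

Let simple_at t := forall i, i != j -> gam i t != gam j t.
Let gap t := \prod_(i | i != j) (gam j t - gam i t).

Lemma gap_neq0 t : simple_at t -> gap t != 0.
Proof.
move=> st; apply/prodf_neq0 => i ij; rewrite subr_eq0 eq_sym; exact: st.
Qed.

(** With [l] frozen, [h] is an explicit trigonometric function and equals (l - gam_j) Q, so gam_j =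
    l - h / Q near t0, where [Q] is nonzero. Continuity of [Q] is enough: since [h] vanishes at t0,
    the quotient is differentiable there. *)
Lemma simple_branch_diff t0 : simple_at t0 ->
  differentiable (gam j) t0 /\
  forall k, 'D_(delta_mx 0 k) (gam j) t0 =
    sin (t0 0 k) * ((c k).[gam j t0] * sg k * (gap t0)^-1).
Proof.
move=> st; set l := gam j t0.
pose h t := c0.[l] + \sum_k (c k).[l] * (sg k * cos (t 0 k)).
pose Q t := \prod_(i | i != j) (l - gam i t).
have hQ t : h t = (l - gam j t) * Q t by rewrite /h -prodE (bigD1 j).
have Q0 : Q t0 != 0 by exact: gap_neq0.
have cQ : {for t0, continuous Q}.
  apply: continuous_bigprod => i; apply: continuousB; first exact: cst_continuous.
  exact: cgam.
have nearQ : \forall t \near t0, Q t != 0 by exact: (cvgr_neq0 _ cQ Q0).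
pose q t := - (Q t)^-1.
have cq : {for t0, continuous q} by apply: continuousN; apply: continuousV.
have h0 : h t0 = 0 by rewrite hQ subrr mul0r.
have dterm k : differentiable (fun t : 'rV[R]_d => (c k).[l] * (sg k * cos (t 0 k))) t0 /\
    forall v, 'd (fun t : 'rV[R]_d => (c k).[l] * (sg k * cos (t 0 k))) t0 v
      = ((c k).[l] * (sg k * - sin (t0 0 k))) * v 0 k.
  have hder s : is_derive s (1 : R) (fun s => (c k).[l] * (sg k * cos s))
      ((c k).[l] * (sg k * - sin s)).
    have -> : (fun s => (c k).[l] * (sg k * cos s)) = (c k).[l] *: (sg k *: (@cos R)).
      by apply/funext.
    by apply: is_derive_eq.
  exact: (differentiable_comp_coord k t0 hder).
have [ds1 ds2] := diff_bigsum (index_enum _) dterm.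
have dh : differentiable h t0 by apply: differentiableD.
have dhE v : 'd h t0 v = \sum_k ((c k).[l] * (sg k * - sin (t0 0 k))) * v 0 k.
  by rewrite -ds2 diffD // diff_cst /= add0r.
have [df1 df2] := differentiable_mul_vanishing dh h0 cq.
have near_eq : \forall t \near t0, gam j t = l + h t * q t.
  apply: filterS nearQ => t Qt; rewrite hQ /q mulrN -mulrA divff // mulr1 opprB.
  by rewrite addrC subrK.
have dg : differentiable (cst l + (fun t => h t * q t)) t0 by apply: differentiableD.
have [dgam dgamE] := near_eq_differentiable near_eq dg.
split=> // k; rewrite deriveE // dgamE diffD // diff_cst /= add0r df2 dhE.
rewrite (bigD1 k) //= big1 => [|i ik]; last first.
  by rewrite mxE (negPf ik) andbF mulr0.
by rewrite mxE !eqxx addr0 mulr1 /q /gap -/l; ring.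
Qed.

Hypothesis simple0 : simple_at 0.
Hypothesis sg_neq0 : forall k, sg k != 0.
Hypothesis c_neq0 : forall k, (c k).[gam j 0] != 0.

(** Near 0 the partial derivatives are sin(t_k) q_k(t), with q_k continuous at 0. As the sine
    vanishes at 0, they are differentiable there, and the Hessian is diagonal with the nonzero
    entries q_k(0). *)
Lemma nondegenerate_branch :
  [/\ \forall t \near (0 : 'rV[R]_d), differentiable (gam j) t,
      forall k, differentiable (partial_derivative k (gam j)) (0 : 'rV[R]_d)
    & Hessian (gam j) 0 \in unitmx].
Proof.
have near_simple : \forall t \near (0 : 'rV[R]_d), simple_at t.
  have near_i i : \forall t \near (0 : 'rV[R]_d), i != j -> gam i t != gam j t.
    case: (boolP (i != j)) => [ij|_]; last by apply: filterE.
    have ci : {for (0 : 'rV[R]_d), continuous (fun t => gam i t - gam j t)}.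
      by apply: continuousB; exact: cgam.
    have gi0 : gam i 0 - gam j 0 != 0 by rewrite subr_eq0 simple0.
    apply: filterS (cvgr_neq0 _ ci gi0) => t; rewrite subr_eq0 //.
  exact: (@filter_forall _ _ _ _ (nbhs_filter _) near_i).
pose q k t := (c k).[gam j t] * sg k * (gap t)^-1.
have cq k : {for (0 : 'rV[R]_d), continuous (q k)}.
  apply: continuousM; last first.
    apply: continuousV; first exact: gap_neq0.
    by apply: continuous_bigprod => i; apply: continuousB; exact: cgam.
  apply: continuousM; last exact: cst_continuous.
  apply: (@continuous_comp _ _ _ (gam j) (horner (c k))); first exact: cgam.
  exact: continuous_horner.
have near_pd k : \forall t \near (0 : 'rV[R]_d),
    partial_derivative k (gam j) t = sin (t 0 k) * q k t.
  by apply: filterS near_simple => t st; case: (simple_branch_diff st) => _ /(_ k).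
have dE k : differentiable (partial_derivative k (gam j)) (0 : 'rV[R]_d) /\
    forall v, 'd (partial_derivative k (gam j)) (0 : 'rV[R]_d) v = q k 0 * v 0 k.
  have [ds1 ds2] := @differentiable_comp_coord R d sin cos k 0 (@is_derive_sin R).
  have s0 : sin ((0 : 'rV[R]_d) 0 k) = 0 by rewrite mxE sin0.
  have [dm1 dm2] := differentiable_mul_vanishing ds1 s0 (cq k).
  have [dp dpE] := near_eq_differentiable (near_pd k) dm1.
  by split=> // v; rewrite dpE dm2 ds2 mxE cos0 mul1r.
split.
- by apply: filterS near_simple => t st; case: (simple_branch_diff st).
- by move=> k; case: (dE k).
have -> : Hessian (gam j) 0 = diag_mx (\row_k q k 0).
  apply/matrixP => k l; rewrite [LHS]mxE /partial_derivative.
  have [d1 d2] := dE l; rewrite deriveE // d2 !mxE eqxx /= mulr_natr.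
  by rewrite eq_sym; case: eqP => // ->.
rewrite unitmxE det_diag unitfE; apply/prodf_neq0 => k _.
by rewrite mxE !mulf_neq0 // invr_eq0; exact: gap_neq0.
Qed.
End Branch.

(** * Spectral edges for a good parameter *)

Section SpectralEdges.
Variables (R : realType) (d : nat) (Gamma : periodic_graph d).
Variables (n : nat) (W : 'I_n -> Gamma) (p : parameters R Gamma).
Local Notation emb := (complex_embedding R).
Local Notation Re := (@complex.Re R).
Local Notation Im := (@complex.Im R).
Local Notation point := ('rV[(R[i])^o]_d).
Local Notation band := (band W p).
Variables (c0 : {poly R}) (c : 'I_d -> {poly R}).
Hypothesis band_product : forall (z : point) lambda, torus z ->
  \prod_(j < n) (lambda - band j z) =
  c0.[lambda] + \sum_k (c k).[lambda] * Re (z 0 k).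
Hypothesis simple : forall e, injective (fun j => band j (real_point R e)).
Hypothesis coprime : forall e k lambda,
  \prod_j (lambda - band j (real_point R e)) = 0 ->
  \prod_j (lambda - band j (real_point R (flip k e))) = 0 -> False.
Implicit Types (x z : point) (t : 'rV[R]_d).

Lemma real_unit_complex (w : R[i]) : `|w| = 1 -> Im w = 0 ->
  w = emb ((-1) ^+ (w == -1)).
Proof.
case: w => a b /=; rewrite normc_def /= => w1 b0; move: w1.
rewrite b0 expr0n addr0 sqrtr_sqr => -[] /eqP.
rewrite eqr_norml => /andP[/orP[] /eqP -> _].
  rewrite (_ : _ == _ = false); first by rewrite expr0.
  by rewrite eq_complex /= -subr_eq0 opprK -mulr2n pnatr_eq0.
by rewrite eq_complex /= oppr0 !eqxx /= expr1 rmorphN1; apply/eqP;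
  rewrite eq_complex /= oppr0 !eqxx.
Qed.

Lemma extremum_real x j : torus x -> local_extremum W p j x ->
  (exists e, x = real_point R e) /\ forall k, (c k).[band j x] != 0.
Proof.
move=> x1 ext.
have crit k : (c k).[band j x] != 0 -> Im (x 0 k) = 0.
  exact: (extremum_critical band_product x1 ext).
have fx : c0.[band j x] + \sum_k (c k).[band j x] * Re (x 0 k) = 0.
  by rewrite -(band_product _ x1); exact: (prod_sub_root (fun i => band i x) j).
move: (band j x) crit fx => lambda crit fx.
(* Where x_k is not real, the value [false] is an arbitrary choice. *)
pose e := [ffun k => x 0 k == -1] : {ffun 'I_d -> bool}.
have xe k : Im (x 0 k) = 0 -> x 0 k = emb (sign_point R e k).
  by move=> xk; rewrite /sign_point ffunE -real_unit_complex.
(* The dispersion equation at [lambda] sees only the coordinates with c_k(lambda) nonzero, so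
   [lambda] is an eigenvalue at every sign point that agrees with [e] there. *)
have agree (e' : {ffun 'I_d -> bool}) : (forall k, (c k).[lambda] != 0 -> e' k = e k) ->
    \prod_i (lambda - band i (real_point R e')) = 0.
  move=> ee; rewrite band_product; last exact: torus_real_point.
  rewrite -[RHS]fx; congr (_ + _); apply: eq_bigr => k _.
  have [ck|ck] := eqVneq ((c k).[lambda]) 0; first by rewrite ck !mul0r.
  by rewrite (xe k (crit k ck)) mxE /sign_point ee.
(* If c_k(lambda) = 0, both [e] and [flip k e] agree with [e] on these coordinates, which gives a
   common eigenvalue. *)
have ck k : (c k).[lambda] != 0.
  apply/negP => /eqP ck; apply: (@coprime e k lambda); first exact: agree.
  apply: agree => l cl; rewrite ffunE; case: eqVneq => [lk|_]; last by rewrite addbF.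
  by rewrite lk ck eqxx in cl.
split=> //; exists e; apply/rowP => k; rewrite mxE; apply: xe; exact: crit.
Qed.

Lemma finite_extrema : finite_set (extrema W p).
Proof.
pose f (ej : {ffun 'I_d -> bool} * 'I_n) : point * R :=
  (real_point R ej.1, band ej.2 (real_point R ej.1)).
apply: sub_finite_set (finite_image f (@finite_finset _ setT)).
move=> [x l] [x1 [j [jl ext]]]; rewrite /fst /snd in x1 jl ext *.
have [[e xe] _] := extremum_real x1 ext.
by exists (e, j) => //; rewrite /f /fst /snd -xe jl.
Qed.

Lemma nondegenerate_extremum x j : torus x -> local_extremum W p j x ->
  nondegenerate_at W p j x.
Proof.
move=> x1 ext; have [[e xe] ck] := extremum_real x1 ext.
apply: (@nondegenerate_branch R d n c0 c (sign_point R e)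
  (fun i t => band i (torus_chart x t)) j).
- by move=> i t; exact: (@continuous_band_chart R d Gamma n W p c0 c
  band_product x i t x1).
- move=> t lambda; rewrite band_product; last exact: torus_torus_chart.
  congr (_ + _); apply: eq_bigr => k _; rewrite Re_torus_chart xe mxE.
  by rewrite mul0r subr0.
- move=> i ij; rewrite torus_chart0 xe; apply: contra_neq ij; exact: simple.
- by move=> k; rewrite /sign_point signr_eq0.
- by move=> k; rewrite torus_chart0; exact: ck.
Qed.

Lemma spectral_edges_of_sparse : spectral_edges_property W p.
Proof.
move=> [x l] exl; have [x1 [j [jl ext]]] := exl; rewrite /fst /snd in x1 jl ext.
split.
- apply: isolated_finite exl; [exact: norm_hausdorff|exact: norm_hausdorff|].
  exact: finite_extrema.
- by move=> i _ exti; exact: nondegenerate_extremum.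
- have [[e xe] _] := extremum_real x1 ext.
  exists j; split; first exact: jl.
  by move=> i il; apply: (@simple e); rewrite -xe; exact: etrans jl (esym il).
Qed.
End SpectralEdges.

Theorem corollary2p6 (R : realType) (d : nat) (Gamma : periodic_graph d)
    (n : nat) (W : 'I_n -> Gamma) :
  (0 < d)%N ->
  orbit_representatives W ->
  connected_graph Gamma ->
  minimally_sparse R W ->
  spectral_edges_conjecture R W.
Proof.
move=> _ repW connG sparse.
(* Evaluation of polynomials at a matrix is stated for sizes that are successors; without orbits
   there is no band, hence no extremum. *)
case: n W repW sparse => [|n] W repW sparse.
  by apply: generic_true => p e [_ [[]]].
have gen_simple := generic_forall (fun e => generic_simple_spectrum R repW e).
have gen_flip := generic_forall (fun ek : {ffun 'I_d -> bool} * 'I_d =>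
  generic_coprime_flip R repW ek.1 ek.2 connG).
apply: generic_sub (generic_and sparse (generic_and gen_simple gen_flip)).
move=> p [/sparse_band_product[c0 [c prodE]] [simp flp]].
apply: (spectral_edges_of_sparse prodE) => [e|e k lambda].
  exact: simple_spectrum_bands (simp e).
exact: coprime_flip_bands (flp (e, k)) lambda.
Qed.
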